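(* If $G$ is a geometrically rigid hyperbolic group, and $G$ acts freely and cocompactly on a simply connected simplicial complex $Z$, then $h^1(Z)>0$.
   Context: A hyperbolic (Gromov/word-hyperbolic) group $G$ is geometrically rigid if it is one-ended and its Gromov boundary $\partial G$ contains no cut pair, i.e. no two distinct points $a,b$ such that $\partial G\setminus\{a,b\}$ is disconnected. For a simplicial complex $Z$, $C^i_c(Z)$ denotes the compactly (finitely) supported simplicial $i$-cochains with $\mathbb Z/2\mathbb Z$ coefficients, identified with finite sets of $i$-simplices; $|\alpha|$ is the cardinality of the set $\alpha$. Let $\mathbf d:C^i_c(Z)\to C^{i+1}_c(Z)$ be the coboundary map and $B^{i+1}_c(Z)=\mathbf d(C^i_c(Z))$. For $\alpha\in B^{i+1}_c(Z)$ put $$\mathrm{MinPrim}(\alpha)=\min\{|\lambda| : \lambda\in C^i_c(Z),\ \mathbf d\lambda=\alpha\},$$ and define the $i$-th coboundary Cheeger constant $$h^i(Z)=\inf_{0\ne\alpha\in B^{i+1}_c(Z)}\frac{|\alpha|}{\mathrm{MinPrim}(\alpha)}.$$ *)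

(* Defs.v *)
From HB Require Import structures.
From mathcomp Require Import all_boot all_order all_algebra finmap.
From mathcomp Require Import all_classical all_reals all_analysis.

Set Implicit Arguments.
Unset Strict Implicit.
Unset Printing Implicit Defensive.

Import Order.TTheory GRing.Theory Num.Theory.
Import numFieldNormedType.Exports.

Local Open Scope classical_set_scope.
Local Open Scope ring_scope.

(* The minimum of a nonempty set of naturals (0 for the empty set). *)
Definition nat_min (A : set nat) : nat :=
  xget 0%N [set n | A n /\ forall m, A m -> (n <= m)%N].

Section GromovBoundary.
Context {R : realType} {T : Type} (d : T -> T -> R) (o : T).

Definition gromov_product (w x y : T) : R := (d w x + d w y - d x y) / 2.

Definition gromov_hyperbolic :=
  exists delta : R, forall w x y z,
    Num.min (gromov_product w x z) (gromov_product w z y) - delta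
      <= gromov_product w x y.

Definition seq_asymptotic (u v : nat -> T) :=
  forall M : R, exists N : nat, forall i j : nat,
    (N <= i)%N -> (N <= j)%N -> M <= gromov_product o (u i) (v j).

Definition converges_at_infinity (u : nat -> T) := seq_asymptotic u u.

Definition boundary_class (u : nat -> T) : set (nat -> T) :=
  [set v | converges_at_infinity v /\ seq_asymptotic u v].

(* Gromov's sequential boundary.  On a hyperbolic space seq_asymptotic is an
   equivalence relation on the sequences converging at infinity, and the points
   of the boundary are its classes. *)
Record gromov_boundary := GromovBoundary {
  boundary_seqs : set (nat -> T) ;
  boundary_seqsP : exists2 u, converges_at_infinity u &
                     boundary_seqs = boundary_class u }.

(* The points q such that liminf (u_i|v_j)_o >= r for some representatives u of
   p and v of q.  For a word metric the Gromov product takes values in (1/2)Z,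
   so the liminf is at least r iff the product eventually is. *)
Definition boundary_nbhd (p : gromov_boundary) (r : R) : set gromov_boundary :=
  [set q | exists u v, [/\ boundary_seqs p u, boundary_seqs q v &
     exists N : nat, forall i j : nat,
       (N <= i)%N -> (N <= j)%N -> r <= gromov_product o (u i) (v j)]].

HB.instance Definition _ := gen_eqMixin gromov_boundary.
HB.instance Definition _ := gen_choiceMixin gromov_boundary.

(* On a hyperbolic space the sets boundary_nbhd p r are a basis of
   neighbourhoods of p in this topology. *)
Definition boundary_open (U : set gromov_boundary) :=
  forall p, U p -> exists r : R, boundary_nbhd p r `<=` U.

Local Lemma boundary_openT : boundary_open setT.
Proof. by move=> p _; exists 0. Qed.

Local Lemma boundary_openI A B :
  boundary_open A -> boundary_open B -> boundary_open (A `&` B).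
Proof.
move=> oA oB p [/oA[r Ar] /oB[s Bs]]; exists (Num.max r s) => q [u [v [pu qv]]].
move=> [N HN]; split; [apply: Ar|apply: Bs]; exists u, v; split => //;
  by exists N => i j Ni Nj; apply: le_trans (HN _ _ Ni Nj); rewrite le_max lexx ?orbT.
Qed.

Local Lemma boundary_open_bigU (I : Type) (f : I -> set gromov_boundary) :
  (forall i, boundary_open (f i)) -> boundary_open (\bigcup_i f i).
Proof.
move=> of_ p [i _ /(of_ i)[r fr]]; exists r => q /fr fq; by exists i.
Qed.

HB.instance Definition _ := isOpenTopological.Build gromov_boundary
  boundary_openT boundary_openI boundary_open_bigU.

Definition cut_pair (a b : gromov_boundary) :=
  a <> b /\ ~ connected (~` [set a; b]).

End GromovBoundary.

Section HyperbolicGroups.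
Context {G : groupType}.
Implicit Types (S K : {fset G}) (x y : G).

Definition letter S x : bool := (x \in S) || (x^-1%g \in S).

Definition spelled_by S x (w : seq G) :=
  all (letter S) w /\ x = (\prod_(s <- w) s)%g.

Definition generates S := forall x, exists w, spelled_by S x w.

Definition word_length S x : nat :=
  nat_min [set n | exists2 w, spelled_by S x w & size w = n].

Definition word_dist (R : realType) S x y : R :=
  (word_length S (x^-1 * y)%g)%:R.

Definition cayley_adj S : rel G := fun x y => letter S (x^-1 * y)%g.

Definition connected_off S K x y :=
  exists2 p : seq G, path (cayley_adj S) x p &
    last x p = y /\ {in x :: p, forall z, z \notin K}.

(* The connected components of the Cayley graph with the vertices K removed. *)
Definition component_off S K (C : set G) :=
  exists2 x, x \notin K & C = connected_off S K x.

Definition one_ended S :=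
  forall K, exists! C : set G, component_off S K C /\ infinite_set C.

End HyperbolicGroups.

(* Hyperbolicity, the number of ends, and the homeomorphism type of the boundary
   do not depend on the finite generating set. *)
Definition geometrically_rigid_hyperbolic (R : realType) (G : groupType) :=
  exists S : {fset G},
    [/\ generates S,
        gromov_hyperbolic (word_dist R S),
        one_ended S &
        forall a b : gromov_boundary (word_dist R S) 1%g, ~ cut_pair a b].

(* Abstract simplicial complexes whose vertex set is the whole of V. *)
Record simplicial_complex (V : choiceType) := SimplicialComplex {
  simplex : set {fset V} ;
  simplex_neq0 : forall s, simplex s -> s != fset0 ;
  simplex_face : forall s t : {fset V},
    simplex s -> (t `<=` s)%fset -> t != fset0 -> simplex t ;
  simplex_vertex : forall v, simplex [fset v]%fset }.

Section Cochains.
Context {V : choiceType} (Z : simplicial_complex V).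
Implicit Types (i : nat) (l a : {fset {fset V}}).

Definition simplex_dim i (s : {fset V}) := simplex Z s /\ #|` s| = i.+1.

(* A finitely supported mod 2 cochain is the finite set of simplices on which
   it takes the value 1. *)
Definition cochain_c i l := forall s, s \in l -> simplex_dim i s.

(* The support of the coboundary; it is finite for every l in cochain_c i as
   soon as Z is locally finite. *)
Definition coboundary i l : set {fset V} :=
  [set t | simplex_dim i.+1 t /\ odd #|` [fset s in l | (s `<=` t)%fset]%fset|].

Definition primitives i a : set {fset {fset V}} :=
  [set l | cochain_c i l /\ coboundary i l = [set` a]].

(* B_c^{i+1}(Z) *)
Definition coboundaries_c i : set {fset {fset V}} :=
  [set a | exists l, primitives i a l].

Definition min_prim i a : nat := nat_min [set #|` l| | l in primitives i a].

Definition cheeger (R : realType) i : \bar R :=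
  ereal_inf [set (#|` a|%:R / (min_prim i a)%:R)%:E
            | a in [set a | coboundaries_c i a /\ a != fset0]].

End Cochains.

Section Realization.
Context (R : realType) {V : choiceType} (Z : simplicial_complex V).

(* The closed geometric simplex spanned by s, in barycentric coordinates. *)
Definition closed_simplex (s : {fset V}) : set (V -> R) :=
  [set x | [/\ forall v, 0 <= x v,
               forall v, v \notin s -> x v = 0 &
               \sum_(v <- s) x v = 1]].

Record realization := Realization {
  coord :> V -> R ;
  coordP : exists2 s, simplex Z s & closed_simplex s coord }.

HB.instance Definition _ := gen_eqMixin realization.
HB.instance Definition _ := gen_choiceMixin realization.

(* The weak topology: U is open iff its trace on each closed simplex is open in
   the Euclidean topology of that simplex. *)
Definition realization_open (U : set realization) :=
  forall s, simplex Z s -> forall x : realization, U x -> closed_simplex s x ->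
  exists2 e : R, 0 < e &
    forall y : realization, closed_simplex s y ->
      (forall v, v \in s -> `|y v - x v| < e) -> U y.

Local Lemma realization_openT : realization_open setT.
Proof. by move=> s _ x _ _; exists 1. Qed.

Local Lemma realization_openI A B :
  realization_open A -> realization_open B -> realization_open (A `&` B).
Proof.
move=> oA oB s Zs x [Ax Bx] sx.
have [e e0 He] := oA s Zs x Ax sx; have [f f0 Hf] := oB s Zs x Bx sx.
exists (Num.min e f); first by rewrite lt_min e0.
by move=> y sy xy; split; [apply: He|apply: Hf] => // v /xy; rewrite lt_min => /andP[].
Qed.

Local Lemma realization_open_bigU (I : Type) (f : I -> set realization) :
  (forall i, realization_open (f i)) -> realization_open (\bigcup_i f i).
Proof.
move=> of_ s Zs x [i _ fx] sx; have [e e0 He] := of_ i s Zs x fx sx.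
by exists e => // y sy xy; exists i => //; apply: He.
Qed.

HB.instance Definition _ := isOpenTopological.Build realization
  realization_openT realization_openI realization_open_bigU.

End Realization.

Definition is_path (R : realType) (X : topologicalType) (f : R -> X) (x y : X) :=
  [/\ {within `[0, 1], continuous f}, f 0 = x & f 1 = y].

Definition path_connected (R : realType) (X : topologicalType) :=
  (exists x : X, True) /\ forall x y : X, exists f : R -> X, is_path f x y.

Definition null_homotopic (R : realType) (X : topologicalType)
    (f : R -> X) (x : X) :=
  exists H : R * R -> X,
    [/\ {within `[0, 1] `*` `[0, 1], continuous H},
        forall t : R, 0 <= t <= 1 -> H (0, t) = f t,
        forall t : R, 0 <= t <= 1 -> H (1, t) = x &
        forall s : R, 0 <= s <= 1 -> H (s, 0) = x /\ H (s, 1) = x].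

Definition simply_connected (R : realType) (X : topologicalType) :=
  path_connected R X /\
  forall (x : X) (f : R -> X), is_path f x x -> null_homotopic f x.

Record simplicial_action (G : groupType) (V : choiceType)
    (Z : simplicial_complex V) := SimplicialAction {
  sact :> G -> V -> V ;
  sact1 : forall v, sact 1%g v = v ;
  sactM : forall g h v, sact (g * h)%g v = sact g (sact h v) ;
  sact_simplex : forall g s, simplex Z s -> simplex Z [fset sact g v | v in s]%fset }.

Section RealizedAction.
Context (R : realType) {G : groupType} {V : choiceType}
        {Z : simplicial_complex V} (act : simplicial_action G Z).

Lemma ract_subproof (g : G) (x : realization R Z) :
  exists2 s, simplex Z s & closed_simplex s (fun v => x (act g^-1%g v)).
Proof.
have actK h : cancel (act h) (act h^-1%g).
  by move=> v; rewrite -sactM mulVg sact1.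
case: (coordP x) => s Zs [x0 xs x1].
exists [fset act g v | v in s]%fset; first exact: sact_simplex.
split=> [v|v vs|]; first exact: x0.
- apply: xs; apply: contra vs => vs; apply/imfsetP; exists (act g^-1%g v) => //=.
  by rewrite -{1}[g]invgK actK.
- rewrite big_imfset /=; last by move=> u v _ _; apply: (can_inj (actK g)).
  by rewrite -x1; apply: eq_bigr => v _; rewrite actK.
Qed.

Definition ract (g : G) (x : realization R Z) : realization R Z :=
  Realization (ract_subproof g x).

Definition acts_freely := forall (g : G) x, ract g x = x -> g = 1%g.

Definition acts_cocompactly :=
  exists2 K : set (realization R Z), compact K &
    forall x, exists g, exists2 y, K y & x = ract g y.

End RealizedAction.

(* Main.v *)
Require Import Defs.
From mathcomp Require Import all_boot all_order all_algebra finmap.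
From mathcomp Require Import zify lra ring.
From mathcomp Require Import all_classical all_reals all_analysis.

(* Let alpha be the coboundary of l, and let Y be the set of positions in G of
   the simplices of alpha (and of 1).  If seen from g all of Y lies, far away, in
   at most two directions, then l is cohomologically trivial near g: sum l along
   a path from g to a point z far out in a third direction.  The result does not
   depend on z, because the boundary minus two points is connected, so that any
   two choices of z are joined by a chain of directions along which geodesics
   fellow-travel; the loops between consecutive ones either bound away from Y, or
   are compared further out, by induction.  These sums form a function A, and
   l + dA is a primitive of alpha supported near the other points g, those where
   Y spreads in three directions.  Such g are coarse branch points of the tree of
   geodesics from 1 to Y, and there are O(|Y|) of them.

   Compactness arguments are done with a free ultrafilter on nat.  That loops of Z
   have fillings is only used in the following form: for every edge loop there is
   a finite vertex set W such that a 1-cochain which is a cocycle on W sums to 0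
   along the loop. *)

Set Implicit Arguments.
Unset Strict Implicit.
Unset Printing Implicit Defensive.

Import Order.TTheory GRing.Theory Num.Theory.
Import numFieldNormedType.Exports.
Local Open Scope classical_set_scope.

(** * Word metrics *)

(** The primitive l may be arbitrarily large compared with alpha, so the radius beyond which it
    vanishes must not enter any constant. This is why the chains of directions are required to exist
    with bounds that do not depend on how far out they have to run; that radius only governs the
    length of the induction. The point 1 is added to Y for the sake of this induction: a direction
    opposite to all of Y is then opposite to 1, so that walking in it increases the word length
    until the support of l is left behind. It is also the root of the tree whose branch points are
    counted, and it costs only a bounded factor because alpha is not empty. The argument takes place
    in G rather than in Z: l is summed along translates of fixed edge paths, which turns it into a
    function of pairs of group elements. Up to translation only finitely many loops are involved at
    a given scale, so one finite set of vertices fills them all, and the function is a cocycle on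
    triples of bounded diameter that are far from Y. *)

Lemma nat_minP (A : set nat) n : A n ->
  A (nat_min A) /\ forall m, A m -> (nat_min A <= m)%N.
Proof.
move=> An; rewrite /nat_min.
have [m [Am mP]] : exists m, A m /\ forall k, A k -> (m <= k)%N.
  have exA : exists n, `[< A n >] by exists n; apply/asboolP.
  case: (ex_minnP exA) => m /asboolP Am mP; exists m; split=> // k Ak.
  by apply: mP; apply/asboolP.
have exm : exists m, [set n | A n /\ forall m, A m -> (n <= m)%N] m by exists m.
by case: (xgetPex 0%N exm).
Qed.

Section WordMetric.
Variables (G : groupType) (S : {fset G}).
Hypothesis genS : generates S.
Implicit Types (x y z g : G) (w : seq G).
Local Open Scope group_scope.

Local Notation len := (word_length S).
Definition wdist x y := len (x^-1 * y).
Local Notation d := wdist.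

Lemma len_spelled x : exists2 w, spelled_by S x w & size w = len x.
Proof.
have [w xw] := genS x.
by have [|[] // ? ? ?] := @nat_minP [set n | exists2 w, spelled_by S x w & size w = n] (size w);
  [exists w | eexists; eassumption].
Qed.

Lemma len_le x w : spelled_by S x w -> (len x <= size w)%N.
Proof.
move=> xw.
have [|_] := @nat_minP [set n | exists2 w, spelled_by S x w & size w = n] (size w).
  by exists w.
by apply; exists w.
Qed.

Lemma len1 : len 1 = 0%N.
Proof.
apply/eqP; rewrite -leqn0; apply: (@len_le 1 [::]); split=> //.
by rewrite big_nil.
Qed.

Lemma len_eq0 x : len x = 0%N -> x = 1.
Proof.
have [w [_ ->] <-] := len_spelled x => /size0nil ->.
by rewrite big_nil.
Qed.

Lemma lenM x y : (len (x * y) <= len x + len y)%N.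
Proof.
have [u [ux ->] <-] := len_spelled x; have [v [vy ->] <-] := len_spelled y.
rewrite -size_cat; apply: len_le; split; first by rewrite all_cat ux.
by rewrite big_cat.
Qed.

Lemma letterV s : letter S s^-1 = letter S s.
Proof. by rewrite /letter invgK orbC. Qed.

Lemma len_letter s : letter S s -> (len s <= 1)%N.
Proof. by move=> sS; apply: (@len_le s [:: s]); split; rewrite /= ?sS // big_seq1. Qed.

Lemma lenV x : len x^-1 = len x.
Proof.
suff le y : (len y^-1 <= len y)%N.
  by apply/eqP; rewrite eqn_leq le -{1}[x]invgK le.
have [w [wy ->] <-] := len_spelled y.
elim: w wy => [|s w IHw] /=; first by rewrite big_nil invg1 len1.
case/andP=> sS /IHw le; rewrite big_cons invgM -addn1.
by apply: leq_trans (lenM _ _) (leq_add le _); rewrite len_letter ?letterV.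
Qed.

Lemma wdistxx x : d x x = 0%N. Proof. by rewrite /d mulVg len1. Qed.
Lemma wdistC x y : d x y = d y x.
Proof. by rewrite /d -lenV invgM invgK. Qed.
Lemma wdist_tri y x z : (d x z <= d x y + d y z)%N.
Proof. by rewrite /d; apply: leq_trans (lenM _ _); rewrite mulgA mulgK. Qed.
Lemma wdist_eq0 x y : d x y = 0%N -> x = y.
Proof. by move=> /len_eq0 xy; rewrite -[y](mulVKg x) xy mulg1. Qed.
Lemma wdist_mull g x y : d (g * x) (g * y) = d x y.
Proof. by rewrite /d invgM mulgA -[(_ * _ * g)%g]mulgA mulVg mulg1. Qed.
Lemma wdist1g x : d 1 x = len x. Proof. by rewrite /d invg1 mul1g. Qed.

(** The point is spelled by the first [k] letters of a shortest word for [x^-1 * y]. *)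
Lemma geod x y k : (k <= d x y)%N ->
  exists2 z, d x z = k & d z y = (d x y - k)%N.
Proof.
have [w [wS xy] sw] := len_spelled (x^-1 * y) => kd.
pose u := take k w; pose v := drop k w.
pose z := (x * \prod_(s <- u) s)%g.
have uS : all (letter S) u by apply/allP => s /mem_take; apply/allP.
have vS : all (letter S) v by apply/allP => s /mem_drop; apply/allP.
have zy : z^-1 * y = \prod_(s <- v) s.
  have -> : y = x * \prod_(s <- w) s by rewrite -xy mulVKg.
  by rewrite -{1}(cat_take_drop k w) big_cat /= /z (mulgA x) mulKg.
have dxz : (d x z <= k)%N.
  rewrite /d /z mulKg; apply: leq_trans (len_le (w := u) _) _; first by split.
  by rewrite size_take; case: ltnP; lia.
have dzy : (d z y <= d x y - k)%N.
  rewrite /d zy; apply: leq_trans (len_le (w := v) _) _; first by split.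
  by rewrite size_drop sw.
have := wdist_tri z x y; exists z; lia.
Qed.

Lemma finite_ball n : exists B : {fset G}, forall x, (len x <= n)%N -> x \in B.
Proof.
elim: n => [|n [B BP]].
  by exists [fset 1%g]%fset => x; rewrite leqn0 => /eqP/len_eq0 ->; rewrite inE.
pose T := ([fset 1%g] `|` S `|` [fset s^-1 | s in S])%fset.
exists [fset (x * s)%g | x in B, s in T]%fset => x xn.
have [xn1|xn1] := leqP (len x) n.
  by apply/imfset2P; exists x; [exact: BP | exists 1; rewrite ?mulg1 // !inE eqxx].
have ex : len x = n.+1 by lia.
have [|z dz zx] := @geod 1 x n; first by rewrite wdist1g; lia.
have {}zx : len (z^-1 * x) = 1%N by rewrite -/(d z x) zx wdist1g; lia.
have [[|s [|? ?]]] := len_spelled (z^-1 * x); rewrite zx // => -[/= /andP[sS _] zs] _.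
rewrite big_seq1 in zs.
apply/imfset2P; exists z; first by apply: BP; rewrite -wdist1g dz.
exists s; last by rewrite -zs mulVKg.
rewrite !inE; case/orP: sS => sS; rewrite ?sS ?orbT //.
by apply/orP; right; apply/imfsetP; exists s^-1; rewrite ?invgK.
Qed.

Lemma exists_parent x : exists y, (len y = (len x).-1 /\ d x y <= 1)%N.
Proof.
case ex : (len x) => [|n]; first by exists x; rewrite wdistxx ex.
have [|z dz zx] := @geod 1 x n; first by rewrite wdist1g; lia.
exists z; rewrite wdistC zx -wdist1g dz wdist1g ex /=; split; lia.
Qed.

(** A fixed choice, so that its iterates give one geodesic from each point to 1 and these geodesics
    form a tree. It is constant at 1, where [(len 1).-1] is 0. *)
Definition parent x := projT1 (cid (exists_parent x)).

Lemma len_parent x : len (parent x) = (len x).-1.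
Proof. by rewrite /parent; case: cid => y []. Qed.

Lemma d_parent x : (d x (parent x) <= 1)%N.
Proof. by rewrite /parent; case: cid => y []. Qed.

Lemma len_iter_parent k x : len (iter k parent x) = (len x - k)%N.
Proof. by elim: k => [|k IHk] /=; rewrite ?subn0 // len_parent IHk subnS. Qed.

Lemma d_iter_parent k x : (k <= len x)%N -> d x (iter k parent x) = k.
Proof.
move=> kx; have : (d x (iter k parent x) <= k)%N.
  elim: k {kx} => [|k IHk] /=; first by rewrite wdistxx.
  have := wdist_tri (iter k parent x) x (parent (iter k parent x)).
  by have := d_parent (iter k parent x); lia.
have := wdist_tri (iter k parent x) 1 x; rewrite !wdist1g len_iter_parent (wdistC _ x); lia.
Qed.

Lemma iter_parent_1 k : iter k parent 1 = 1.
Proof. by apply: len_eq0; rewrite len_iter_parent len1. Qed.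

End WordMetric.

(** * Leaves and branchings of a finite tree given by its parent map *)

Section Forests.
Variables (T : eqType) (X : seq T) (r : T) (f : T -> T).
Hypotheses (X_uniq : uniq X) (Xr : r \in X).
Hypothesis f_closed : forall x, x \in X -> x != r -> f x \in X.
Implicit Types x y : T.

Definition children x := [seq y <- X | (y != r) && (f y == x)].

Let nch x := size (children x).

(** Every element other than [r] is a child of exactly one element. *)
Lemma sum_children : ((\sum_(x <- X) nch x).+1 = size X)%N.
Proof.
under eq_bigr do rewrite /nch size_filter -sum1_count big_mkcond /=.
rewrite exchange_big /= (bigD1_seq r) //= big1 => [|x _]; last by rewrite eqxx.
rewrite add0n -sum1_size [RHS](bigD1_seq r) //= big_seq_cond [in RHS]big_seq_cond.
rewrite add1n; congr S; apply: eq_bigr => y /andP[yX yr].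
rewrite (bigD1_seq (f y)) ?f_closed //= yr eqxx big1 // => x.
by rewrite eq_sym => /negbTE ->.
Qed.

(** Sum over [X] of the pointwise inequality [[nch x > 1] + 1 <= [nch x = 0] + nch x], compared with
    [sum_children]. *)
Lemma forest_branch_le_leaves :
  (count (fun x => 1 < nch x) X < count (fun x => nch x == 0) X)%N.
Proof.
suff: (count (fun x => 1 < nch x) X + size X <=
       count (fun x => nch x == 0) X + \sum_(x <- X) nch x)%N.
  by have := sum_children; lia.
rewrite -sum1_size -!sum1_count [X in (X + _ <= _)%N]big_mkcond /=.
rewrite [X in (_ <= X + _)%N]big_mkcond /= -!big_split /=.
by apply: leq_sum => x _; case: (nch x) => [|[]].
Qed.

(** The converse estimate, from [[nch x = 0] + nch x <= K * [nch x > 1] + 1]. *)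
Lemma forest_leaves_le K : (forall x, x \in X -> (nch x <= K)%N) ->
  (count (fun x => nch x == 0) X <= (K * count (fun x => 1 < nch x) X).+1)%N.
Proof.
move=> chK.
suff: (count (fun x => nch x == 0) X + \sum_(x <- X) nch x <=
       K * count (fun x => 1 < nch x) X + size X)%N.
  by have := sum_children; lia.
rewrite -sum1_size -!sum1_count big_distrr [X in (X + _ <= _)%N]big_mkcond /=.
rewrite [X in (_ <= X + _)%N]big_mkcond -!big_split /= big_seq [leqRHS]big_seq.
by apply: leq_sum => x /chK; case: (nch x) => [|[]] /=; lia.
Qed.

End Forests.

Lemma size_ge2 (T : eqType) (s : seq T) : uniq s -> (1 < size s)%N ->
  exists x y, [/\ x \in s, y \in s & x != y].
Proof.
case: s => [|x [|y s]] //= /andP[xs _] _; exists x, y.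
by rewrite !inE !eqxx orbT; split=> //; apply: contra xs => /eqP ->; rewrite inE eqxx.
Qed.

(** * Gromov products and branch points *)

Section GromovProducts.
Variables (G : groupType) (S : {fset G}).
Hypothesis genS : generates S.
Implicit Types (x y z g w : G).
Local Open Scope group_scope.
Local Open Scope nat_scope.
Local Notation len := (word_length S).
Local Notation d := (wdist S).

(* Twice the Gromov product, so as to stay in nat. *)
Definition gprod w x y := d w x + d w y - d x y.

Lemma gprodE w x y : gprod w x y + d x y = d w x + d w y.
Proof. by rewrite /gprod subnK // (wdistC genS w x) (wdist_tri genS). Qed.

Lemma gprodC w x y : gprod w x y = gprod w y x.
Proof. by rewrite /gprod addnC (wdistC genS x y). Qed.

Lemma gprod_mull g w x y : gprod (g * w)%g (g * x)%g (g * y)%g = gprod w x y.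
Proof. by rewrite /gprod !wdist_mull. Qed.

Lemma gprod_lel w x y : gprod w x y <= (d w x).*2.
Proof. have := gprodE w x y; have := wdist_tri genS x w y; lia. Qed.

Lemma gprod_ler w x y : gprod w x y <= (d w y).*2.
Proof. by rewrite gprodC gprod_lel. Qed.

Lemma gprod_basel w w' x y : gprod w x y <= gprod w' x y + (d w w').*2.
Proof.
have := gprodE w x y; have := gprodE w' x y.
have := wdist_tri genS w' w x; have := wdist_tri genS w' w y; lia.
Qed.

End GromovProducts.

Ltac pose_new t :=
  let T := type of t in
  lazymatch goal with H : T |- _ => fail | _ => pose proof t end.

(** Supplies [lia] with the defining identity of each Gromov product in sight and with the symmetry
    of each distance. The proofs below then only have to list the triangle inequalities and the
    instances of hyperbolicity on which they rest. *)
Ltac dlia genS :=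
  repeat match goal with
  | |- context[gprod ?S ?w ?x ?y] => pose_new (gprodE genS w x y)
  | H : context[gprod ?S ?w ?x ?y] |- _ => pose_new (gprodE genS w x y)
  end;
  repeat match goal with
  | |- context[wdist ?S ?x ?y] => pose_new (wdistC genS x y)
  | H : context[wdist ?S ?x ?y] |- _ => pose_new (wdistC genS x y)
  end; lia.

Section Hyperbolic.
Variables (G : groupType) (S : {fset G}).
Hypothesis genS : generates S.
Local Notation len := (word_length S).
Local Notation d := (wdist S).
Local Notation gp := (gprod S).
Local Notation par := (parent genS).
Variable delta : nat.
Hypothesis hypS : forall w x y z : G,
  minn (gp w x z) (gp w z y) <= gp w x y + delta.
Implicit Types (x y z g w : G).

Lemma hyp4 w x y z t :
  minn (gp w x z) (minn (gp w z t) (gp w t y)) <= gp w x y + delta.*2.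
Proof. by have := hypS w x y z; have := hypS w z y t; lia. Qed.

(** * Points of divergence of the geodesics from 1 to a finite set *)

Section Counting.
Variables (L : nat) (B : seq G).
Hypotheses (L_large : 2 * delta < L).
Hypothesis ballB : forall x, len x <= L -> x \in B.
Variable Y : seq G.
Hypothesis Y1 : 1%g \in Y.

Let anc x := iter L par x.

(** The tree of the chosen geodesics from 1 to [Y], sampled at the levels divisible by [L]. Between
    two sampled levels there is more room than the fellow-travelling constant [2 * delta]. *)
Definition skeleton : seq G :=
  undup [seq x <- [seq iter k par y | y <- Y, k <- iota 0 (len y).+1] | L %| len x].

Lemma skeletonP x : reflect
  (exists y k, [/\ y \in Y, k <= len y, L %| len y - k & x = iter k par y])
  (x \in skeleton).
Proof.
rewrite mem_undup mem_filter; apply: (iffP andP) => [[Lx]|[y [k [yY ky Lk ->]]]].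
  case/allpairsPdep => y [k [yY]]; rewrite mem_iota add0n ltnS => /= ky xE.
  by exists y, k; split=> //; rewrite -(len_iter_parent genS) -xE.
split; first by rewrite (len_iter_parent genS).
by apply/allpairsPdep; exists y, k; rewrite mem_iota add0n ltnS ky.
Qed.

Lemma skeleton_uniq : uniq skeleton. Proof. exact: undup_uniq. Qed.

Lemma skeleton1 : 1%g \in skeleton.
Proof. by apply/skeletonP; exists 1%g, 0; rewrite (len1 S). Qed.

Lemma len_gt0 x : x != 1%g -> 0 < len x.
Proof. by rewrite lt0n; apply: contra => /eqP/(len_eq0 genS) ->. Qed.

Lemma skeleton_len x : x \in skeleton -> L %| len x.
Proof. by case/skeletonP => y [k [_ _ Lk ->]]; rewrite (len_iter_parent genS). Qed.

Lemma skeleton_ge x : x \in skeleton -> x != 1%g -> L <= len x.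
Proof. by move=> /skeleton_len Lx x1; rewrite dvdn_leq ?len_gt0. Qed.

Lemma skeleton_anc x : x \in skeleton -> x != 1%g -> anc x \in skeleton.
Proof.
move=> xX x1; have := skeleton_ge xX x1.
case/skeletonP: xX => y [k [yY ky Lk ->]]; rewrite (len_iter_parent genS) => Lle.
apply/skeletonP; exists y, (L + k); split=> //; first lia; last by rewrite /anc iterD.
by rewrite addnC subnDA dvdn_sub.
Qed.

Let ch := children skeleton 1%g anc.

Lemma chP x y : reflect [/\ y \in skeleton, y != 1%g & anc y = x] (y \in ch x).
Proof.
by rewrite mem_filter -andbA; apply: (iffP and3P) => -[? /eqP ? ?]; split=> //; apply/eqP.
Qed.

Lemma d_child x y : y \in ch x -> d x y = L /\ len y = len x + L.
Proof.
case/chP => yX y1 <-; have Ly := skeleton_ge yX y1; split.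
  by rewrite (wdistC genS) /anc (d_iter_parent genS).
by rewrite /anc (len_iter_parent genS) subnK.
Qed.

(** There are at most as many branchings as leaves, and a leaf is the last sampled point on the
    geodesic to some [y], found [len y %% L] steps below [y]. *)
Lemma skeleton_branch : count (fun x => 1 < size (ch x)) skeleton <= size Y.
Proof.
apply: leq_trans (ltnW (forest_branch_le_leaves skeleton_uniq skeleton1 skeleton_anc)) _.
rewrite -(size_map (fun y => iter (len y %% L) par y) Y) -size_filter.
apply: uniq_leq_size; first by rewrite filter_uniq ?skeleton_uniq.
move=> x; rewrite mem_filter => /andP[/nilP chx /skeletonP[y [k [yY ky Lk xE]]]].
apply/mapP; exists y => //; rewrite xE; congr iter.
have [kL|Lk'] := ltnP k L.
  by rewrite -(subnK ky) -modnDml (eqP Lk) add0n modn_small.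
suff : iter (k - L) par y \in ch x by rewrite /ch chx.
have lE : len (iter (k - L) par y) = len y - k + L.
  by rewrite (len_iter_parent genS); lia.
apply/chP; split.
- apply/skeletonP; exists y, (k - L); split=> //; first lia.
  by rewrite -(len_iter_parent genS) lE dvdn_add.
- by apply/eqP => e; move: lE; rewrite e (len1 S); lia.
- by rewrite /anc -iterD xE; congr iter; lia.
Qed.

(** Two of the chosen geodesics may run side by side without sharing a vertex, so the place where
    they diverge need not be a branching of the skeleton. It is visible in the tree of pairs of
    close points at the same level. *)
Definition fellow_pairs : seq (G * G) :=
  [seq q <- [seq (x, y) | x <- skeleton, y <- skeleton]
     | (len q.1 == len q.2) && (d q.1 q.2 <= 2 * delta)].

Lemma pair_neq1 x y : len x = len y -> (x, y) != (1%g, 1%g) ->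
  (x != 1%g) && (y != 1%g).
Proof.
move=> lxy; apply: contraR; rewrite xpair_eqE negb_and !negbK.
case/orP => /eqP e; move: lxy; rewrite e (len1 S).
  by move/esym/(len_eq0 genS) ->; rewrite !eqxx.
by move/(len_eq0 genS) ->; rewrite !eqxx.
Qed.

Let anc2 (q : G * G) := (anc q.1, anc q.2).
Let ch2 := children fellow_pairs (1%g, 1%g) anc2.

Lemma fellow_pairsP q : reflect
  [/\ q.1 \in skeleton, q.2 \in skeleton, len q.1 = len q.2 & d q.1 q.2 <= 2 * delta]
  (q \in fellow_pairs).
Proof.
case: q => x y; rewrite mem_filter /=; apply: (iffP andP).
  by case=> /andP[/eqP lxy dxy] /allpairsP[[x' y'] /= [x'X y'X [ex ey]]]; subst x y.
by case=> xX yX -> ->; rewrite eqxx; split=> //; apply/allpairsP; exists (x, y).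
Qed.

Lemma fellow_uniq : uniq fellow_pairs.
Proof.
rewrite filter_uniq // allpairs_uniq ?skeleton_uniq // => -[x y] [x' y'] _ _ /=.
by case=> -> ->.
Qed.

Lemma fellow1 : (1%g, 1%g) \in fellow_pairs.
Proof. by apply/fellow_pairsP; rewrite /= skeleton1 (wdistxx S). Qed.

(* Hyperbolicity: being at distance at most 2 delta reproduces itself L levels
   down, so that the pairs form a forest as well. *)
Lemma fellow_anc q : q \in fellow_pairs -> q != (1%g, 1%g) -> anc2 q \in fellow_pairs.
Proof.
case: q => x y /fellow_pairsP[/= xX yX lxy dxy] q1.
have /andP[x1 y1] := pair_neq1 lxy q1.
have Lx := skeleton_ge xX x1; have Ly := skeleton_ge yX y1.
apply/fellow_pairsP; split=> /=; rewrite ?skeleton_anc //.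
  by rewrite /anc !(len_iter_parent genS) lxy.
have := hyp4 1%g (anc x) (anc y) x y.
have := d_iter_parent genS Lx; have := d_iter_parent genS Ly; rewrite -/(anc x) -/(anc y).
have := len_iter_parent genS L x; have := len_iter_parent genS L y.
rewrite -/(anc x) -/(anc y).
have := wdist1g S x; have := wdist1g S y; have := wdist1g S (anc x); have := wdist1g S (anc y).
dlia genS.
Qed.

(** Both coordinates of a child lie within [L] of those of its parent. *)
Lemma size_ch2 q : size (ch2 q) <= size B * size B.
Proof.
case: q => x x'.
rewrite -(size_allpairs (fun b b' => (x * b, x' * b')%g) B B); apply: uniq_leq_size.
  by rewrite filter_uniq ?fellow_uniq.
move=> [y y']; rewrite mem_filter => /andP[/andP[q1 /eqP[ax ax']] qP].
have /fellow_pairsP[/= yX y'X lyy' dyy'] := qP.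
have /andP[y1 y'1] := pair_neq1 lyy' q1.
have /d_child[dy _] : y \in ch x by apply/chP.
have /d_child[dy' _] : y' \in ch x' by apply/chP.
apply/allpairsP; exists (x^-1 * y, x'^-1 * y')%g; split=> /=.
- by apply: ballB; rewrite -/(d x y) dy.
- by apply: ballB; rewrite -/(d x' y') dy'.
- by rewrite !mulVKg.
Qed.

Let branching x := 1 < size (ch x).
Let bpairs := [seq q <- fellow_pairs | branching q.1 || branching q.2].

Lemma unary_child x y y' : ~~ branching x -> y \in ch x -> y' \in ch x -> y = y'.
Proof.
rewrite -leqNgt; case: (ch x) => [|z [|? ?]] // _.
by rewrite !inE => /eqP -> /eqP ->.
Qed.

Lemma fellow_child q q' : q' \in ch2 q -> (q'.1 \in ch q.1) && (q'.2 \in ch q.2).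
Proof.
case: q q' => [x x'] [y y']; rewrite mem_filter => /andP[/andP[q1 /eqP[ax ax']]].
case/fellow_pairsP => /= yX y'X lyy' dyy'.
have /andP[y1 y'1] := pair_neq1 lyy' q1.
by apply/andP; split; apply/chP.
Qed.

(** Such a pair is determined by which coordinate branches, by that coordinate, and by the
    displacement to the other one, which lies in [B]. *)
Lemma size_bpairs : size bpairs <= 2 * (size Y * size B).
Proof.
pose br := [seq x <- skeleton | branching x].
have sbr : size br <= size Y by rewrite size_filter skeleton_branch.
apply: (@leq_trans (2 * (size br * size B))); last by rewrite leq_mul2l leq_mul2r sbr orbT.
rewrite mul2n -addnn -{1}(size_allpairs (fun x b => (x, x * b)%g) br B).
rewrite -(size_allpairs (fun x b => (x * b, x)%g) br B) -size_cat.
apply: uniq_leq_size; first by rewrite filter_uniq ?fellow_uniq.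
move=> [x y]; rewrite mem_filter mem_cat => /andP[/= bxy /fellow_pairsP[/= xX yX _ dxy]].
case/orP: bxy => [bx|b_y]; apply/orP; [left|right]; apply/allpairsP.
  exists (x, x^-1 * y)%g; split=> /=; rewrite ?mulVKg ?mem_filter ?bx //.
  by apply: ballB; rewrite -/(d x y); lia.
exists (y, y^-1 * x)%g; split=> /=; rewrite ?mulVKg ?mem_filter ?b_y //.
by apply: ballB; rewrite -/(d y x) (wdistC genS); lia.
Qed.

(** If neither coordinate branches, each has at most one child, and so does the pair. *)
Lemma fellow_branch : count (fun q => 1 < size (ch2 q)) fellow_pairs <= size bpairs.
Proof.
rewrite -size_filter; apply: uniq_leq_size; first by rewrite filter_uniq ?fellow_uniq.
move=> q; rewrite !mem_filter => /andP[q2 ->]; rewrite andbT.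
have uch : uniq (ch2 q) by rewrite filter_uniq ?fellow_uniq.
have [[u v] [[u' v'] [/fellow_child/andP[/= uc vc] /fellow_child/andP[/= uc' vc'] uv]]] :=
  size_ge2 uch q2.
apply: contraT; rewrite negb_or => /andP[n1 n2]; case/eqP: uv.
by rewrite (unary_child n1 uc uc') (unary_child n2 vc vc').
Qed.

(** The coordinates of a pair are [2 * delta]-close, so that keeping the first one is enough. The
    points of [Y] account for geodesics that end before they have diverged. *)
Definition branch_centers : seq G :=
  [seq q.1 | q <- bpairs ++ [seq q <- fellow_pairs | size (ch2 q) == 0]] ++ Y.

(** At most [2 * size Y * size B] pairs have a branching coordinate. By [forest_leaves_le] the
    leaves of the tree of pairs number at most [(size B) ^ 2] times as many, plus one. *)
Lemma size_branch_centers :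
  size branch_centers <= (2 * (size B) ^ 3 + 2 * size B + 2) * size Y.
Proof.
rewrite /branch_centers size_cat size_map size_cat.
rewrite (size_filter (fun q => size (ch2 q) == 0)).
have := forest_leaves_le fellow_uniq fellow1 fellow_anc (fun q _ => size_ch2 q).
rewrite -/ch2 => le; have := fellow_branch; have := size_bpairs.
have : 0 < size Y by case: (Y) Y1.
move: le; set l := count _ _; set b := count _ _.
move=> l1 Y0 sb bb; have := leq_trans bb sb => {bb} bb.
have : l <= (size B * size B * (2 * (size Y * size B))).+1.
  by apply: leq_trans l1 _; rewrite ltnS leq_mul2l bb orbT.
rewrite !expnS expn0 muln1; nia.
Qed.

(* Where the geodesics from the base point to y1 and y2 diverge, either one of
   them branches off in the skeleton, or the pair has no fellow child. *)
Lemma dist_branch_center R g y1 y2 : y1 \in Y -> y2 \in Y ->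
  gp g y1 1%g < R -> gp g y2 1%g < R -> gp g y1 y2 < R ->
  exists2 x, x \in branch_centers & d g x <= 4 * (R + L).
Proof.
move=> Y_1 Y_2 gy1 gy2 gy12.
pose at_ y j := iter (len y - j * L) par y.
pose P j := [&& j * L <= len y1, j * L <= len y2 & d (at_ y1 j) (at_ y2 j) <= 2 * delta].
have P0 : exists j, P j.
  exists 0; rewrite /P /at_ mul0n !subn0 /=.
  suff at0 y : iter (len y) par y = 1%g by rewrite !at0 (wdistxx S).
  by apply: (len_eq0 genS); rewrite (len_iter_parent genS) subnn.
have Pb j : P j -> j <= len y1.
  case/and3P => le _ _; apply: leq_trans le; rewrite -{1}[j]muln1 leq_mul2l.
  by apply/orP; right; lia.
(* [j] is the last level at which both geodesics are present and still close. *)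
case: (ex_maxnP P0 Pb) => j /and3P[jy1 jy2 djj] jmax.
have at_len y i : i * L <= len y -> len (at_ y i) = i * L.
  by move=> ?; rewrite (len_iter_parent genS) subKn.
have at_d y i : i * L <= len y -> d y (at_ y i) = len y - i * L.
  by move=> ?; rewrite (d_iter_parent genS) ?leq_subr.
have at_X y i : y \in Y -> i * L <= len y -> at_ y i \in skeleton.
  move=> yY iy; apply/skeletonP; exists y, (len y - i * L); split=> //.
    exact: leq_subr.
  by rewrite subKn // dvdn_mull.
have l1 := wdist1g S (at_ y1 j); have l2 := wdist1g S (at_ y2 j).
rewrite at_len // in l1; rewrite at_len // in l2.
have e1 := at_d _ _ jy1; have e2 := at_d _ _ jy2.
have m1 := wdist1g S y1; have m2 := wdist1g S y2.
have t1 := hyp4 1%g y1 y2 (at_ y1 j) (at_ y2 j).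
have jS : j.+1 * L = j * L + L by rewrite mulSn addnC.
have lg := wdist1g S g.
have s1 := hypS 1%g g (at_ y1 j) y1.
(* If one of the geodesics ends before level [j.+1], its endpoint is less than [L] away from level
   [j] and serves as the center. *)
have [jy|] := boolP ((j.+1 * L <= len y1) && (j.+1 * L <= len y2)); last first.
  rewrite negb_and -!ltnNge => /orP[] lty.
    exists y1; first by rewrite mem_cat Y_1 orbT.
    by move: t1 s1 => t1 s1; dlia genS.
  exists y2; first by rewrite mem_cat Y_2 orbT.
  by move: t1 s1 => t1 s1; dlia genS.
case/andP: jy => Jy1 Jy2.
have farJ : 2 * delta < d (at_ y1 j.+1) (at_ y2 j.+1).
  rewrite ltnNge; apply/negP => le.
  by have := jmax j.+1; rewrite /P Jy1 Jy2 le /= ltnn => /(_ isT).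
have L1 := wdist1g S (at_ y1 j.+1); have L2 := wdist1g S (at_ y2 j.+1).
rewrite at_len // in L1; rewrite at_len // in L2.
have E1 := at_d _ _ Jy1; have E2 := at_d _ _ Jy2.
(* Since the points at level [j.+1] are more than [2 * delta] apart, this gives
   [gp 1 y1 y2 < 2 * (j.+1 * L)]: the targets diverge within one level after [j]. *)
have T1 := hyp4 1%g (at_ y1 j.+1) (at_ y2 j.+1) y1 y2.
exists (at_ y1 j); last by dlia genS.
have q_pair : (at_ y1 j, at_ y2 j) \in fellow_pairs.
  by apply/fellow_pairsP; rewrite /= !at_X ?at_len.
rewrite mem_cat; apply/orP; left; apply/mapP; exists (at_ y1 j, at_ y2 j) => //.
rewrite mem_cat !(mem_filter _ _ fellow_pairs) q_pair !andbT /=.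
(* Without a branching coordinate, the only possible child of the pair consists of the two points at
   level [j.+1], and these are too far apart. *)
case: (boolP (branching _ || _)) => //=; rewrite negb_or => /andP[n1 n2].
have at_ch y : y \in Y -> j.+1 * L <= len y -> at_ y j.+1 \in ch (at_ y j).
  move=> yY jy; apply/chP; split; first exact: at_X.
    by apply/eqP => e; have := at_len _ _ jy; rewrite e (len1 S); lia.
  by rewrite /anc /at_ -iterD; congr iter; lia.
rewrite size_eq0; apply/eqP/nilP; rewrite /nilp.
have := @fellow_child (at_ y1 j, at_ y2 j).
have := mem_filter (fun q' => (q' != (1%g, 1%g)) && (anc2 q' == (at_ y1 j, at_ y2 j))) ^~
  fellow_pairs.
rewrite -/(children _ _ _ _) -/ch2; case: (ch2 _) => [|[u v] l] // mf fc.
have /andP[/= uc vc] := fc (u, v) (mem_head _ _).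
have /andP[_ /fellow_pairsP[/= _ _ _]] := etrans (esym (mf (u, v))) (mem_head _ _).
rewrite (unary_child n1 uc (at_ch _ Y_1 Jy1)) (unary_child n2 vc (at_ch _ Y_2 Jy2)).
by move: farJ; lia.
Qed.
End Counting.

(** [D] is the union of the balls of radius [4 * (R + L)] about the branch centers. The condition on
    [g] says that 1, [y1] and [y2] lie in three different directions from [g]. *)
Lemma count_branch_points R : exists C, forall Y : {fset G}, 1%g \in Y ->
  exists2 D : {fset G}, #|` D| <= C * #|` Y| &
    forall g y1 y2, y1 \in Y -> y2 \in Y ->
      gp g y1 1%g < R -> gp g y2 1%g < R -> gp g y1 y2 < R -> g \in D.
Proof.
pose L := (2 * delta).+1.
have [B BP] := finite_ball genS L; have [B' BP'] := finite_ball genS (4 * (R + L)).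
exists ((2 * (size B) ^ 3 + 2 * size B + 2) * size B') => Y Y1.
pose cs := branch_centers L Y.
exists [fset x in [seq (c * b)%g | c <- cs, b <- B']]%fset.
  apply: leq_trans (_ : size [seq (c * b)%g | c <- cs, b <- B'] <= _).
    by rewrite card_fseq size_undup.
  rewrite size_allpairs mulnAC leq_mul2r.
  by rewrite (size_branch_centers (ltnSn _) BP Y1) orbT.
move=> g y1 y2 Y_1 Y_2 g1 g2 g12.
have [c cC gc] := dist_branch_center (ltnSn _) Y1 Y_1 Y_2 g1 g2 g12.
rewrite inE; apply/allpairsP; exists (c, c^-1 * g)%g.
split=> //=; last by rewrite mulVKg.
by apply: BP'; rewrite -/(d c g) (wdistC genS).
Qed.

End Hyperbolic.

(** * Potentials of coarse cocycles *)

Section Chains.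
Variables (G : groupType) (S : {fset G}).
Local Notation len := (word_length S).
Local Notation gp := (gprod S).

(** Large when, seen from [p], the point [x] lies nearly in the direction of [a] or of [b]. *)
Definition ecc (p a b x : G) := maxn (gp p x a) (gp p x b).

(** The factor 2 lets one walk from the base point toward [x] for a little longer than [ecc 1 a b x]
    steps, which is enough to leave the directions of [a] and [b], while [x] and [y] still cannot be
    told apart. *)
Definition chain_link (N : nat) (a b x y : G) :=
  (2 * ecc 1%g a b x + N <= gp 1%g x y) && (2 * ecc 1%g a b y + N <= gp 1%g x y).

(* A chain stays away from a and b, and its mesh gets finer close to them: it is
   a discrete path in the complement of two points of the boundary. *)
Definition chain_connected (N rho rho' R : nat) :=
  forall a b z z' : G, R <= len a -> R <= len b -> R <= len z -> R <= len z' ->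
  ecc 1%g a b z <= rho -> ecc 1%g a b z' <= rho ->
  forall (T : nat) (K : pred G), K z -> K z' -> (forall x, T <= len x -> K x) ->
  exists s, [/\ path (chain_link N a b) z s, last z s = z' &
                all (fun x => K x && (ecc 1%g a b x <= rho')) (z :: s)].

(** Each of two given points [a] and [b] can have a large product with at most one of [x1], [x2],
    [x3], so one of the three is opposite to both. *)
Definition three_directions (M : nat) :=
  forall J, exists x1 x2 x3 : G,
    [/\ J <= len x1, J <= len x2 & J <= len x3] /\
    [/\ gp 1%g x1 x2 <= M, gp 1%g x1 x3 <= M & gp 1%g x2 x3 <= M].

End Chains.

Section Potential.
Variables (G : groupType) (S : {fset G}).
Hypothesis genS : generates S.
Local Notation len := (word_length S).
Local Notation d := (wdist S).
Local Notation gp := (gprod S).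
Local Notation par := (parent genS).
Variable delta : nat.
Hypothesis hypS : forall w x y z : G,
  minn (gp w x z) (gp w z y) <= gp w x y + delta.
Implicit Types (x y z g w p : G).

(* Seen from p, every point of Y lies in the direction of a or of b. *)
Definition covered (Y : {fset G}) (R : nat) p a b :=
  forall y, y \in Y -> R <= gp p y a \/ R <= gp p y b.

(** The parent tree translated so that its root is [z]: iterating [step z] follows a geodesic to [z]
    and then stays there. *)
Definition step z g := (z * par (z^-1 * g))%g.

Lemma iter_stepE z g i : iter i (step z) g = (z * iter i par (z^-1 * g))%g.
Proof. by elim: i => [|i IHi] /=; rewrite ?mulVKg // IHi /step mulKg. Qed.

Lemma d_step_l z g i : d z (iter i (step z) g) = d z g - i.
Proof. by rewrite iter_stepE {1}/wdist mulKg (len_iter_parent genS). Qed.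

Lemma d_step_r z g i : i <= d z g -> d g (iter i (step z) g) = i.
Proof.
move=> ig; rewrite iter_stepE -{1}[g](mulVKg z) wdist_mull (d_iter_parent genS) //.
Qed.

Lemma step_stable z g i : d z g <= i -> iter i (step z) g = z.
Proof. by move=> gi; apply/esym/(wdist_eq0 genS); rewrite d_step_l; lia. Qed.

Lemma d_step z g : d g (step z g) <= 1.
Proof. by rewrite /step -{1}[g](mulVKg z) wdist_mull d_parent. Qed.

Lemma step_between z g i :
  d g (iter i (step z) g) + d (iter i (step z) g) z = d g z.
Proof.
have [iz|zi] := leqP i (d z g).
  by rewrite d_step_r // (wdistC genS _ z) d_step_l (wdistC genS g); lia.
by rewrite step_stable ?(wdistxx S) ?addn0 // ltnW.
Qed.

Variables (Y : {fset G}) (f0 r0 T : nat) (c : G -> G -> bool).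
Hypothesis Y1 : 1%g \in Y.
Definition far_from_Y g := forall y, y \in Y -> f0 < d g y.
Hypothesis c_cocycle : forall g h k, d g h <= r0 -> d h k <= r0 -> d g k <= r0 ->
  far_from_Y g -> c g h (+) c h k (+) c k g = false.
Hypothesis c_support : forall g h, d g h <= 1 -> T <= len g -> c g h = false.

Lemma c_diag g : far_from_Y g -> c g g = false.
Proof.
move=> gY; have := c_cocycle (g := g) (h := g) (k := g).
by rewrite (wdistxx S) => /(_ isT isT isT gY); case: c.
Qed.

(* The sum of c along the first n steps of the geodesic from g to z. *)
Fixpoint csum z n g :=
  if n is m.+1 then c g (step z g) (+) csum z m (step z g) else false.

Definition transport z g := csum z (d z g) g.

(** Steps made after the arrival at [z] contribute [c z z], which vanishes. This allows geodesics of
    different lengths to be summed over the same number of steps. *)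
Lemma csum_stable z g n : far_from_Y z -> d z g <= n -> csum z n g = transport z g.
Proof.
rewrite /transport => zY; elim: n g => [|n IHn] g; first by rewrite leqn0 => /eqP ->.
case E : (d z g) => [|m] gn /=; last first.
  have /= dE := d_step_l z g 1; rewrite IHn; last by lia.
  by congr (_ (+) csum _ _ _); lia.
have -> : g = z by apply/esym/(wdist_eq0 genS).
have sz : step z z = z by rewrite /step mulVg (iter_parent_1 genS 1 : par 1%g = 1%g) mulg1.
rewrite sz c_diag // IHn ?(wdistxx S) //.
Qed.

Lemma addb_square s1 s2 gg' hh' gh gh1 h'g l : s1 (+) s2 = gh1 (+) l ->
  gg' (+) gh1 (+) h'g = false -> gh (+) hh' (+) h'g = false ->
  (gg' (+) s1) (+) (hh' (+) s2) = gh (+) l.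
Proof. by case: s1 s2 gg' hh' gh gh1 h'g l => [] [] [] [] [] [] [] []. Qed.

(** The strip between the two paths is cut into squares, and each square into two triangles whose
    first vertex lies on the path of [g]. The sums then differ by the first and the last rung
    only. *)
Lemma csum_fellow z n r g h : r < r0 ->
  (forall i, i <= n -> d (iter i (step z) g) (iter i (step z) h) <= r) ->
  (forall i, i <= n -> far_from_Y (iter i (step z) g)) ->
  csum z n g (+) csum z n h = c g h (+) c (iter n (step z) g) (iter n (step z) h).
Proof.
move=> rr0; elim: n g h => [|n IHn] g h gh gY /=; first by rewrite addbb.
have [gh0 gY0] := (gh 0 isT, gY 0 isT); have [/= gh1 gY1] := (gh 1 isT, gY 1 isT).
have IH : csum z n (step z g) (+) csum z n (step z h) =
  c (step z g) (step z h) (+) c (iter n (step z) (step z g)) (iter n (step z) (step z h)).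
  by apply: IHn => i ni; rewrite -!iterSr; [apply: gh | apply: gY].
rewrite -!iterS !iterSr.
have dg := d_step z g; have dh := d_step z h.
have tri := wdist_tri genS (step z g) g (step z h).
have t1 : c g (step z g) (+) c (step z g) (step z h) (+) c (step z h) g = false.
  by apply: c_cocycle => //; lia.
have t2 : c g h (+) c h (step z h) (+) c (step z h) g = false.
  by apply: c_cocycle => //; simpl in *; lia.
exact: addb_square IH t1 t2.
Qed.

(** Geodesics from [g] and [h] to the same [z] stay [D + 2 * delta] close at equal times, and the
    last rung of the strip between them is [c z z]. *)
Lemma transport_change D z g h : d g h <= D -> D + 2 * delta < r0 ->
  (forall x, d g x + d x z = d g z -> far_from_Y x) ->
  transport z g = c g h (+) transport z h.
Proof.
move=> ghD Dr0 gzY; pose n := maxn (d z g) (d z h).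
have zY : far_from_Y z by apply: gzY; rewrite (wdistxx S) addn0.
rewrite -(csum_stable (n := n)) ?leq_maxl // -(csum_stable (g := h) (n := n)) ?leq_maxr //.
have := @csum_fellow z n (D + 2 * delta) g h Dr0.
rewrite !step_stable ?leq_maxl ?leq_maxr // c_diag // addbF => <-.
- by case: csum; case: csum.
- move=> i ni; set x := iter i _ g; set x' := iter i _ h.
  have := hyp4 hypS z x x' g h.
  have := d_step_l z g i; have := d_step_l z h i; rewrite -/x -/x'.
  have := step_between z g i; have := step_between z h i; rewrite -/x -/x'.
  have := wdist_tri genS g z h; have := wdist_tri genS h z g.
  dlia genS.
- by move=> i _; apply: gzY; rewrite step_between.
Qed.

(** Every [y] is nearly in the direction of [a] or [b], which [z] avoids, so
    [gp p z y <= e + delta]; a point [x] on a geodesic to [z] inherits this bound up to another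
    [delta]. The second bound holds because a product with [y] is at most [2 * d p y]. *)
Lemma covered_far R p a b z e x y :
  covered Y R p a b -> ecc S p a b z <= e -> e + delta < R ->
  d p x + d x z = d p z -> y \in Y ->
  gp p x y <= e + 2 * delta /\ R <= 2 * d p y.
Proof.
move=> cov; rewrite geq_max => /andP[za zb] eR pxz yY.
have zy : gp p z y <= e + delta /\ R <= 2 * d p y.
  have := gprod_lel genS p y a; have := gprod_lel genS p y b.
  have := hypS p z a y; have := hypS p z b y.
  by case: (cov y yY); lia.
have := hypS p y z x; have := gprod_lel genS p x y; have := gprodC genS p x y.
have := gprodC genS p y z; move: pxz zy; move: (cov) => _; dlia genS.
Qed.

Variables (rho rho' R0 R1 : nat).
(** The least excess for which [ecc + n'] steps from [p] toward [z] strictly increase the word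
    length: the product of the new point with 1, seen from [p], is at most [ecc + 2 * delta]. *)
Let n' := 2 * delta + 1.
Hypothesis rho_ge : 2 * delta <= rho.
Hypothesis rho_rho' : rho <= rho'.
Hypothesis chainS : chain_connected S (2 * n') rho rho' R0.
Hypothesis r0_ge : rho' + n' + 2 * delta < r0.
Hypothesis R1_ge : 2 * R0 + 2 * rho' + 4 * delta + 2 * f0 + 2 <= R1.
Let T1 := T + rho + 2 * delta.
Let T2 := T1 + R1.

(** By [covered_far], [d x y >= d p y - rho' - 2 * delta] with [2 * d p y >= R1]; the terms [rho'],
    [delta] and [f0] in the bound on [R1] are there for this. *)
Lemma covered_far_from_Y p a b z e : e <= rho' ->
  covered Y R1 p a b -> ecc S p a b z <= e ->
  forall x, d p x + d x z = d p z -> far_from_Y x.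
Proof.
move=> ee' cov ze x pxz y yY.
have [|] := @covered_far R1 p a b z e x y cov ze _ pxz yY; first by lia.
dlia genS.
Qed.

(** As [z] is opposite to 1 seen from [p], a geodesic from [p] to [z] loses at most
    [rho + 2 * delta] of word length and never enters the ball of radius [T], outside of which [c]
    vanishes. *)
Lemma transport_outside p a b z : T1 <= len p ->
  covered Y R1 p a b -> ecc S p a b z <= rho -> transport z p = false.
Proof.
move=> Tp cov ze.
have lenx x : d p x + d x z = d p z -> T <= len x.
  move=> pxz; have [|] := @covered_far R1 p a b z rho x 1%g cov ze _ pxz Y1; first by lia.
  by have := wdist1g S x; have := wdist1g S p; move: Tp; rewrite /T1; dlia genS.
suff csum0 k i : csum z k (iter i (step z) p) = false by exact: (csum0 _ 0).
elim: k i => [|k IHk] i //=; rewrite -iterS IHk addbF c_support ?d_step //.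
exact/lenx/step_between.
Qed.

(* Follow the geodesic from p to z until Y, seen from there, is further away: the
   same pair a, b still covers Y, and z and z' are both opposite to it. *)
Lemma transport_link p a b z z' : a \in Y -> b \in Y ->
  (forall p', len p < len p' -> covered Y R1 p' a b ->
     ecc S p' a b z <= rho -> ecc S p' a b z' <= rho ->
     transport z p' = transport z' p') ->
  covered Y R1 p a b -> ecc S p a b z <= rho' -> ecc S p a b z' <= rho' ->
  2 * ecc S p a b z + 2 * n' <= gp p z z' ->
  transport z p = transport z' p.
Proof.
move=> aY bY IH' cov ze z'e zz'.
(* By the hypothesis on [gp p z z'], geodesics to [z] and [z'] fellow-travel during these first [l]
   steps. *)
pose e := ecc S p a b z; pose l := e + n'; rewrite -/e in ze zz'.
have [za zb] : gp p z a <= e /\ gp p z b <= e by split; rewrite ?leq_maxl ?leq_maxr.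
have dpz := gprod_lel genS p z z'.
have [|p' pp' p'z] := @geod _ _ genS p z l; first by rewrite /l; lia.
have pxz : d p p' + d p' z = d p z by rewrite pp' p'z; rewrite /l; lia.
have dpp' : d p p' <= rho' + n' by rewrite pp' /l; lia.
have farz := covered_far_from_Y (leqnn rho') cov ze.
have farz' := covered_far_from_Y (leqnn rho') cov z'e.
rewrite (transport_change dpp' r0_ge farz) (transport_change dpp' r0_ge farz').
congr (_ (+) _).
have Rl : e + delta < R1 by lia.
have near y : y \in Y -> gp p p' y <= e + 2 * delta.
  by move=> yY; have [] := covered_far cov (leqnn e) Rl pxz yY.
have gpz : gp p p' z = 2 * l by rewrite /gprod; lia.
have a' : gp p p' a <= e + delta by have := hypS p z a p'; rewrite (gprodC genS p z p'); lia.
have b' : gp p p' b <= e + delta by have := hypS p z b p'; rewrite (gprodC genS p z p'); lia.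
have gpz' : 2 * l - delta <= gp p p' z' by have := hypS p p' z' z; lia.
have z'a : gp p z' a <= e + delta by have := hypS p z a z'; lia.
have z'b : gp p z' b <= e + delta by have := hypS p z b z'; lia.
have n'E : n' = 2 * delta + 1 by [].
have lE : l = e + n' by [].
clear ze z'e farz farz' aY bY dpp' Rl dpz.
apply: IH'.
- have := near _ Y1; have := wdist1g S p; have := wdist1g S p'.
  clear near cov a' b' gpz gpz' z'a z'b za zb zz' p'z pxz; dlia genS.
(* Moving to [p'] changes the product of [y] with [a] by [2 * l] minus the products of [p'] with [y]
   and with [a]. Those two add up to at most [2 * e + 3 * delta], so the product grows; likewise for
   [b]. *)
- move=> y yY; have := near _ yY => ny; case: (cov y yY) => R1y; [left|right].
    clear near cov b' gpz gpz' z'a z'b za zb zz' p'z pxz; dlia genS.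
  clear near cov a' gpz gpz' z'a z'b za zb zz' p'z pxz; dlia genS.
(* Seen from [p'], the products of [z] and [z'] with [a] and [b] have dropped from [rho'] to at most
   [2 * delta], hence below [rho]. This is what allows the induction to restart. *)
- clear near cov zz' z'a z'b gpz'; rewrite geq_max; apply/andP; split.
    by have := hypS p a p' z; clear b' zb; dlia genS.
  by have := hypS p b p' z; clear a' za; dlia genS.
- clear near cov zz' gpz; rewrite geq_max; apply/andP; split.
    by have := hypS p a p' z'; clear b' zb z'b; dlia genS.
  by have := hypS p b p' z'; clear a' za z'a; dlia genS.
Qed.

(** Induction on how far [p] is from leaving the ball of radius [T1]. Inside it, a chain of
    directions at [p] leads from [z] to [z'], and [transport_link] reduces each of its links to
    longer base points. *)
Lemma transport_unique p a b z z' : a \in Y -> b \in Y -> covered Y R1 p a b ->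
  ecc S p a b z <= rho -> ecc S p a b z' <= rho -> T2 <= len z -> T2 <= len z' ->
  transport z p = transport z' p.
Proof.
move=> aY bY; have [n] := ubnP (T1 - len p).
elim: n => // n IHn in p z z' *; rewrite ltnS => pn cov ze z'e Tz Tz'.
have [Tp|pT] := leqP T1 (len p).
  by rewrite (transport_outside Tp cov ze) (transport_outside Tp cov z'e).
pose tr x := (p^-1 * x)%g.
have trK x : (p * tr x)%g = x by rewrite /tr mulVKg.
have gpE x y : gp 1%g (tr x) (tr y) = gp p x y.
  by rewrite -(gprod_mull S p) mulg1 !trK.
have eccE x : ecc S 1%g (tr a) (tr b) (tr x) = ecc S p a b x by rewrite /ecc !gpE.
have lenE x : len (tr x) = d p x by [].
have dlen x : len x <= len p + d p x.
  by rewrite -(wdist1g S x) -(wdist1g S p); apply: wdist_tri.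
have dY y : y \in Y -> R0 <= d p y.
  move=> yY; have [||_] := @covered_far R1 p a b z rho p y cov ze _ _ yY.
  - by lia. - by rewrite (wdistxx S). - by lia.
(* [chain_connected] is stated at the base point 1, so everything is translated by [p^-1]. The
   predicate keeps the chain at word length at least [T2], as the induction hypothesis requires;
   since [len p < T1], it holds beyond [T2 + T1]. *)
have [|||||||||s [ps ls als]] := @chainS (tr a) (tr b) (tr z) (tr z') _ _ _ _ _ _ (T2 + T1)
    (fun x => T2 <= len (p * x)%g).
- exact: dY. - exact: dY.
- by rewrite lenE; have := dlen z; rewrite /T2 in Tz; lia.
- by rewrite lenE; have := dlen z'; rewrite /T2 in Tz'; lia.
- by rewrite eccE.
- by rewrite eccE.
- by rewrite trK.
- by rewrite trK.
- move=> x; have := wdist_tri genS 1%g p (p * x)%g; rewrite -(wdist1g S (p * x)%g).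
  have -> : d p (p * x)%g = len x by rewrite /wdist mulKg.
  move: pT; rewrite -(wdist1g S p); dlia genS.
suff : forall x, path (chain_link S (2 * n') (tr a) (tr b)) (tr x) s ->
    last (tr x) s = tr z' ->
    all (fun x => (T2 <= len (p * x)%g) && (ecc S 1%g (tr a) (tr b) x <= rho')) (tr x :: s) ->
    transport x p = transport z' p by apply.
elim: s {ps ls als} => [|y s IHs] x /=.
  by move=> _ /(congr1 (fun t => p * t)%g); rewrite !trK => ->.
have -> : y = tr (p * y)%g by rewrite /tr mulKg.
case/andP => /andP[xy _] ps ls /and3P[/andP[Tx ex] /andP[Ty ey] als].
rewrite -(IHs _ ps ls) /=; last by rewrite Ty ey.
rewrite trK in Tx; rewrite trK in Ty; rewrite !eccE in ex ey xy; rewrite gpE in xy.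
apply: (transport_link aY bY _ cov ex ey xy) => p' pp' cov' xe' ye'.
by apply: IHn => //; lia.
Qed.

Variables (D M : nat).
Hypothesis r0D : D + 2 * delta < r0.
Hypothesis dirS : three_directions S M.
Hypothesis rhoM : M + 2 * delta + 2 * D <= rho.

(** Stated with all of [Y] instead of a covering pair, so that the choice of [z] at [g] does not
    involve [a] and [b]. *)
Definition far_direction g z := T2 <= len z /\ forall y, y \in Y -> gp g z y <= rho.

(** A direction chosen at [g] with product at most [M + 2 * delta] with [Y] also serves for [h]: the
    slack [2 * D] in [rho] and in the covering radius absorbs the change of base point. Then [A g]
    and [A h] are transports to the same [z], and [transport_change] compares them. *)
Lemma potential_exists : exists A : G -> bool, forall g h a b, d g h <= D ->
  a \in Y -> b \in Y -> covered Y (R1 + 2 * D) g a b -> c g h = A g (+) A h.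
Proof.
(* The default value concerns points that have no far direction; the [g] and [h] of the conclusion
   have one. *)
pose A g := if pselect (exists z, far_direction g z) is left H
            then transport (projT1 (cid H)) g else false.
have AE g z a b : a \in Y -> b \in Y -> covered Y R1 g a b -> far_direction g z ->
    A g = transport z g.
  move=> aY bY cov gz; rewrite /A; case: pselect => [H|[]]; last by exists z.
  case: cid => z' [Tz' z'Y] /=; case: gz => Tz zY.
  by apply: (transport_unique aY bY cov); rewrite ?geq_max ?z'Y ?zY.
exists A => g h a b gh aY bY cov.
have covg : covered Y R1 g a b by move=> y /cov[]; [left|right]; lia.
have covh : covered Y R1 h a b.
  move=> y /cov[]; [left|right].
    by have := gprod_basel genS g h y a; lia.
  by have := gprod_basel genS g h y b; lia.
have [z [Tz zY]] : exists z, T2 <= len z /\ forall y, y \in Y -> gp g z y <= M + 2 * delta.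
  have [x1 [x2 [x3 [[l1 l2 l3] [m12 m13 m23]]]]] := dirS (T2 + len g).
  have lenE x : T2 + len g <= len x -> T2 <= len (g * x)%g.
    have := wdist_tri genS 1%g g (g * x)%g; rewrite -(wdist1g S (g * x)%g).
    have -> : d g (g * x)%g = len x by rewrite /wdist mulKg.
    rewrite -(wdist1g S g); dlia genS.
  have gpE x y : gp g (g * x)%g (g * y)%g = gp 1%g x y.
    by rewrite -{1}(mulg1 g) gprod_mull.
  rewrite -gpE in m12; rewrite -gpE in m13; rewrite -gpE in m23.
  have : exists z, [/\ T2 <= len z, gp g z a <= M + delta & gp g z b <= M + delta].
    have := hypS g (g * x1)%g (g * x2)%g a; have := hypS g (g * x1)%g (g * x2)%g b.
    have := hypS g (g * x1)%g (g * x3)%g a; have := hypS g (g * x1)%g (g * x3)%g b.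
    have := hypS g (g * x2)%g (g * x3)%g a; have := hypS g (g * x2)%g (g * x3)%g b.
    rewrite !(gprodC genS g a) !(gprodC genS g b).
    have [n1|n1] := boolP ((gp g (g * x1)%g a <= M + delta) && (gp g (g * x1)%g b <= M + delta)).
      by exists (g * x1)%g; case/andP: n1; rewrite lenE.
    have [n2|n2] := boolP ((gp g (g * x2)%g a <= M + delta) && (gp g (g * x2)%g b <= M + delta)).
      by exists (g * x2)%g; case/andP: n2; rewrite lenE.
    by exists (g * x3)%g; split; [exact: lenE| |]; lia.
  case=> z [Tz za zb]; exists z; split=> // y /covg.
  have := hypS g z a y; have := hypS g z b y.
  have : M + 2 * delta < R1 by lia.
  by move=> *; lia.
rewrite (AE g z a b) ?(AE h z a b) //.
- rewrite (transport_change (h := h) gh r0D) ?addbK //.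
  apply: (covered_far_from_Y rho_rho' covg).
  by rewrite geq_max; apply/andP; split; apply: leq_trans (zY _ _) _; rewrite //; lia.
- split=> // y yY; have := zY y yY; have := gprod_basel genS h g z y.
  by rewrite (wdistC genS h g); lia.
- by split=> // y yY; have := zY y yY; lia.
Qed.

End Potential.

(** * The Gromov boundary *)

Section WordGromov.
Variables (R : realType) (G : groupType) (S : {fset G}).
Hypothesis genS : generates S.
Local Notation gp := (gprod S).
Local Open Scope ring_scope.

Lemma gromov_productE (w x y : G) :
  gromov_product (word_dist R S) w x y = (gp w x y)%:R / 2.
Proof.
rewrite /gromov_product /word_dist -/(wdist S w x) -/(wdist S w y) -/(wdist S x y).
by rewrite -natrD -(gprodE genS) natrD addrK.
Qed.

(** The constant is doubled along with the products, then rounded up to a natural number. *)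
Lemma gprod_hyperbolic : gromov_hyperbolic (word_dist R S) ->
  exists delta : nat, forall w x y z : G,
    (minn (gp w x z) (gp w z y) <= gp w x y + delta)%N.
Proof.
case=> e eP; pose n := Num.bound `|2 * e|; exists n => w x y z.
have nP : 2 * e < n%:R.
  by apply: le_lt_trans (ler_norm _) (archi_boundP (normr_ge0 _)).
have := eP w x y z; rewrite !gromov_productE.
rewrite -(ler_nat R) natrD.
have [le|le] := leqP (gp w x z) (gp w z y).
  by rewrite min_l ?ler_pM2r ?invr_gt0 ?ltr0n ?ler_nat //; lra.
by rewrite min_r ?ler_pM2r ?invr_gt0 ?ltr0n ?ler_nat ?(ltnW le) //; lra.
Qed.

End WordGromov.

Section Boundary.
Variables (R : realType) (G : groupType) (S : {fset G}).
Hypothesis genS : generates S.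
Local Notation len := (word_length S).
Local Notation d := (wdist S).
Local Notation gp := (gprod S 1%g).
Local Notation par := (parent genS).
Variable delta : nat.
Hypothesis hypS : forall w x y z : G,
  (minn (gprod S w x z) (gprod S w z y) <= gprod S w x y + delta)%N.
Implicit Types (x y z g : G) (u v w : nat -> G).

Local Notation bd := (gromov_boundary (word_dist R S) (1%g : G)).

Definition asymptotic u v := forall M, exists N, forall i j,
  N <= i -> N <= j -> M <= gp (u i) (v j).

Lemma seq_asymptoticE u v : seq_asymptotic (word_dist R S) 1%g u v <-> asymptotic u v.
Proof.
split=> uv M.
  have [N NP] := uv (M%:R / 2)%R; exists N => i j Ni Nj.
  have := NP i j Ni Nj; rewrite (gromov_productE R genS) -(ler_nat R); lra.
have [N NP] := uv (Num.bound `|2 * M|%R); exists N => i j Ni Nj.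
have := NP i j Ni Nj; rewrite (gromov_productE R genS) -(ler_nat R).
have : (2 * M < (Num.bound `|2 * M|)%:R)%R.
  by apply: le_lt_trans (ler_norm _) (archi_boundP (normr_ge0 _)).
lra.
Qed.

Lemma asymptotic_sym u v : asymptotic u v -> asymptotic v u.
Proof.
by move=> uv M; have [N NP] := uv M; exists N => i j Ni Nj; rewrite (gprodC genS) NP.
Qed.

Lemma asymptotic_trans v u w : asymptotic u v -> asymptotic v w -> asymptotic u w.
Proof.
move=> uv vw M; have [N1 P1] := uv (M + delta); have [N2 P2] := vw (M + delta).
exists (maxn N1 N2) => i j; rewrite !geq_max => /andP[i1 i2] /andP[j1 j2].
have := P1 i (maxn N1 N2) i1 (leq_maxl _ _); have := P2 (maxn N1 N2) j (leq_maxr _ _) j2.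
by have := hypS 1%g (u i) (w j) (v (maxn N1 N2)); lia.
Qed.

Lemma bpoint_subproof u : asymptotic u u ->
  exists2 v, converges_at_infinity (word_dist R S) 1%g v &
    boundary_class (word_dist R S) 1%g u = boundary_class (word_dist R S) 1%g v.
Proof. by move=> /seq_asymptoticE cu; exists u. Qed.

Definition bpoint u (cu : asymptotic u u) : bd := GromovBoundary (bpoint_subproof cu).

Definition brep (q : bd) : nat -> G := projT1 (cid2 (boundary_seqsP q)).

Lemma brep_conv q : asymptotic (brep q) (brep q).
Proof. by rewrite /brep; case: cid2 => u /= /seq_asymptoticE. Qed.

Lemma brep_seqs q v : boundary_seqs q v <-> asymptotic v v /\ asymptotic (brep q) v.
Proof.
rewrite /brep; case: cid2 => u /= _ ->.
by split=> -[] /seq_asymptoticE cv /seq_asymptoticE uv.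
Qed.

Lemma bd_eq (p q : bd) : asymptotic (brep p) (brep q) -> p = q.
Proof.
move=> pq; have e : boundary_seqs p = boundary_seqs q.
  apply/seteqP; split=> v /brep_seqs[cv pv]; apply/brep_seqs; split=> //.
    exact: asymptotic_trans (asymptotic_sym pq) pv.
  exact: asymptotic_trans pq pv.
case: p q {pq} e => [P pP] [Q qQ] /= e; subst Q.
by rewrite (Prop_irrelevance pP qQ).
Qed.

Lemma brep_bpoint u (cu : asymptotic u u) : asymptotic (brep (bpoint cu)) u.
Proof.
have : boundary_seqs (bpoint cu) u by split; exact/seq_asymptoticE.
by case/brep_seqs.
Qed.

(** Since [u] and [v] both converge, hyperbolicity propagates one small product far out to all
    products far out, at the cost of [2 * delta]. *)
Lemma not_asymptotic u v : asymptotic u u -> asymptotic v v -> ~ asymptotic u v ->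
  exists E N, forall i j, N <= i -> N <= j -> gp (u i) (v j) <= E.
Proof.
move=> cu cv uv.
have [M MP] : exists M, forall N, exists i j, [/\ N <= i, N <= j & gp (u i) (v j) < M].
  apply: contrapT => H; apply: uv => M; apply: contrapT => H'; apply: H; exists M => N.
  apply: contrapT => H; apply: H'; exists N => i j Ni Nj; rewrite leqNgt; apply/negP => lt.
  by apply: H; exists i, j.
have [N1 P1] := cu (M + 2 * delta); have [N2 P2] := cv (M + 2 * delta).
exists (M + 2 * delta), (maxn N1 N2) => i j; rewrite !geq_max => /andP[i1 i2] /andP[j1 j2].
have [i' [j' []]] := MP (maxn N1 N2); rewrite !geq_max => /andP[i'1 i'2] /andP[j'1 j'2] lt.
have := hyp4 hypS 1%g (u i') (v j') (u i) (v j).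
by have := P1 i' i i'1 i1; have := P2 j j' j2 j'2; lia.
Qed.

Lemma bd_neq (p q : bd) : p <> q ->
  exists E N, forall i j, N <= i -> N <= j -> gp (brep p i) (brep q j) <= E.
Proof.
move=> pq; apply: not_asymptotic; try exact: brep_conv.
by move/bd_eq.
Qed.

(** Basic neighbourhoods may be tested on the chosen representatives: changing the representatives
    of both points costs [2 * delta]. *)
Lemma bd_openP (U : set bd) :
  (forall p, U p -> exists M, forall q,
    (exists N, forall i j, N <= i -> N <= j -> M <= gp (brep p i) (brep q j)) -> U q) ->
  open U.
Proof.
move=> UP; suff : boundary_open U by [].
move=> p /UP[M MP]; exists ((M + 2 * delta)%:R / 2)%R => q [u [v [pu qv [N NP]]]].
apply: MP; case/brep_seqs: pu => _ /(_ (M + 2 * delta))[N1 P1].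
case/brep_seqs: qv => _ /(_ (M + 2 * delta))[N2 P2].
exists (maxn N1 N2) => i j; rewrite !geq_max => /andP[i1 i2] /andP[j1 j2].
pose k := (N + N1 + N2).
have := NP k k; rewrite (gromov_productE R genS) => /(_ _ _).
have Nk : N <= k by rewrite /k; lia.
move=> /(_ Nk Nk); rewrite ler_pM2r ?invr_gt0 ?ltr0n // ler_nat => uv.
have k1 : N1 <= k by rewrite /k; lia.
have k2 : N2 <= k by rewrite /k; lia.
have := P1 i k i1 k1; have := P2 j k j2 k2; rewrite (gprodC genS 1%g (brep q j)).
by have := hyp4 hypS 1%g (brep p i) (brep q j) (u k) (v k); lia.
Qed.

Lemma len_to_infty u : asymptotic u u -> forall M, exists N, forall i, N <= i -> M <= len (u i).
Proof.
move=> cu M; have [N NP] := cu (2 * M); exists N => i Ni.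
by have := NP i i Ni Ni; have := gprod_lel genS 1%g (u i) (u i); rewrite (wdist1g S); lia.
Qed.

End Boundary.

(** * Limits along an ultrafilter, and infinitude of the boundary *)

Section UltraLimits.
Variables (G : groupType) (S : {fset G}).
Hypothesis genS : generates S.
Local Notation len := (word_length S).
Local Notation d := (wdist S).
Local Notation gp := (gprod S 1%g).
Local Notation par := (parent genS).
Variable delta : nat.
Hypothesis hypS : forall w x y z : G,
  (minn (gprod S w x z) (gprod S w z y) <= gprod S w x y + delta)%N.
Implicit Types (x y z : G) (u v w g h : nat -> G).

Variable U : set_system nat.
Hypothesis ultraU : UltraFilter U.
Hypothesis U_oo : forall N, U [set k | N <= k].

Lemma ultra_pigeonhole (T : eqType) (s : seq T) (f : nat -> T) :
  U [set k | f k \in s] -> exists b, U [set k | f k = b].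
Proof.
elim: s => [|b s IHs].
  by move=> U0; have [k] := filter_ex U0.
have [Ub|Ub] := in_ultra_setVsetC [set k | f k = b] ultraU; first by exists b.
move=> Us; apply: IHs; apply: filterS (filterI Ub Us) => k /= [fb].
by rewrite inE => /orP[/eqP|].
Qed.

(** A limit of the sequence [g]: [u] is a geodesic ray from 1, and the last clause says that [u j]
    lies on a geodesic from 1 to [g k] for almost all [k]. *)
Definition ultra_ray u (g : nat -> G) :=
  [/\ forall j, len (u j) = j, forall j, d (u j) (u j.+1) <= 1 &
      forall j, U [set k | gp (u j) (g k) = 2 * j]].

(** At level [j] the geodesic from [g k] to 1 passes through one of finitely many points, and the
    ultrafilter selects one of them. *)
Lemma ultra_ray_exists g : (forall N, U [set k | N <= len (g k)]) ->
  exists u, ultra_ray u g.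
Proof.
move=> gU; pose pt j k := iter (len (g k) - j) par (g k).
have ptj j : exists x, U [set k | j <= len (g k) /\ pt j k = x].
  have [B BP] := finite_ball genS j.
  have [|x Ux] := @ultra_pigeonhole _ B (pt j).
    apply: filterS (gU j) => k /= jk; apply: BP.
    by rewrite (len_iter_parent genS); lia.
  by exists x; apply: filterS (filterI (gU j) Ux).
have [u uP] := choice ptj; exists u; split=> j.
- have [k [jk <-]] := filter_ex (uP j); rewrite (len_iter_parent genS); lia.
- have [k [[jk <-] [jSk <-]]] := filter_ex (filterI (uP j) (uP j.+1)).
  rewrite (wdistC genS) /pt; have -> : len (g k) - j = (len (g k) - j.+1).+1 by lia.
  exact: d_parent.
- apply: filterS (uP j) => k /= [jk <-].
  have := gprodE genS 1%g (pt j k) (g k).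
  rewrite !(wdist1g S) (len_iter_parent genS) (wdistC genS) (d_iter_parent genS) ?leq_subr //.
  by rewrite /pt; lia.
Qed.

Lemma ultra_gprod u v g h E : ultra_ray u g -> ultra_ray v h ->
  U [set k | gp (g k) (h k) <= E] -> forall i j, gp (u i) (v j) <= E + 2 * delta.
Proof.
move=> [ul _ ug] [vl _ vh] gh i j.
have [k /= [[gu hv] ghE]] := filter_ex (filterI (filterI (ug i) (vh j)) gh).
have := hyp4 hypS 1%g (g k) (h k) (u i) (v j).
have := gprod_lel genS 1%g (u i) (v j); have := gprod_ler genS 1%g (u i) (v j).
rewrite (gprodC genS 1%g (g k)) !(wdist1g S) ul vl; lia.
Qed.

Lemma ray_gprod u g i j : ultra_ray u g -> 2 * minn i j <= gp (u i) (u j) + delta.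
Proof.
case=> ul _ ug; have [k /= [gi gj]] := filter_ex (filterI (ug i) (ug j)).
by have := hypS 1%g (u i) (u j) (g k); rewrite (gprodC genS 1%g (g k)); lia.
Qed.

Lemma ray_asymptotic u g : ultra_ray u g -> asymptotic S u u.
Proof.
move=> ug M; exists (M + delta) => i j Ni Nj.
by have := @ray_gprod u g i j ug; lia.
Qed.

Variable R : realType.
Local Notation bd := (gromov_boundary (word_dist R S) (1%g : G)).

(** Translate the middle of a long geodesic to 1: its two ends have Gromov product 0, and so, up to
    [2 * delta], do the rays to which they converge. *)
Lemma opposite_rays : (forall n, exists x, n <= len x) ->
  exists u v g h, [/\ ultra_ray u g, ultra_ray v h & forall i j, gp (u i) (v j) <= 2 * delta].
Proof.
move=> Ginf.
have xy k : exists q : G * G, [/\ k <= len q.1, k <= len q.2 & gp q.1 q.2 = 0].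
  have [g kg] := Ginf (2 * k).
  have [|m dm mg] := @geod _ _ genS 1%g g k; first by rewrite (wdist1g S); lia.
  rewrite (wdist1g S) in mg.
  exists (m^-1 * 1, m^-1 * g)%g; split=> /=.
  - by rewrite mulg1 (lenV genS) -(wdist1g S) dm.
  - by rewrite -/(wdist S m g); lia.
  - have -> : gp (m^-1 * 1)%g (m^-1 * g)%g = gprod S m 1%g g.
      by rewrite -{1}(mulVg m) gprod_mull.
    by rewrite /gprod (wdistC genS m) dm mg (wdist1g S); lia.
have [q qP] := choice xy.
have lenU (f : nat -> G) : (forall k, k <= len (f k)) -> forall N, U [set k | N <= len (f k)].
  by move=> fk N; apply: filterS (U_oo N) => k /= Nk; apply: leq_trans Nk (fk k).
have [|u ug] := @ultra_ray_exists (fun k => (q k).1); first by apply: lenU => k; case: (qP k).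
have [|v vh] := @ultra_ray_exists (fun k => (q k).2); first by apply: lenU => k; case: (qP k).
exists u, v; do 2!eexists; split; [exact: ug | exact: vh |].
apply: (ultra_gprod (E := 0) ug vh).
by apply: filterS (U_oo 0) => k _ /=; case: (qP k) => _ _ ->.
Qed.

Lemma cayley_adj_d x y : cayley_adj S x y -> d x y <= 1.
Proof. exact: len_letter. Qed.

Lemma d1_cayley_adj x y : d x y = 1 -> cayley_adj S x y.
Proof.
move=> xy; rewrite /cayley_adj; have [[|s [|? ?]]] := len_spelled genS (x^-1 * y)%g.
- by move=> _; rewrite -/(d x y) xy.
- by case=> /= /andP[sS _]; rewrite big_seq1 => -> _.
- by move=> _; rewrite -/(d x y) xy.
Qed.

Lemma infinite_unbounded (C : set G) : infinite_set C -> forall n, exists2 x, C x & n <= len x.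
Proof.
move=> Cinf n; apply: contrapT => H; apply: Cinf.
have [B BP] := finite_ball genS n.
apply: (@sub_finite_set _ _ [set` B]); last exact: finite_fset.
move=> g Cg /=; apply: BP; rewrite leqNgt; apply/negP => lt.
by apply: H; exists g => //; exact: ltnW.
Qed.

Lemma unbounded_infinite (C : set G) : (forall n, exists2 x, C x & n <= len x) -> infinite_set C.
Proof.
move=> Cn /finite_fsetP[X XE].
have [g] := Cn (\max_(x <- X) len x).+1; rewrite XE /= => gX.
by rewrite ltnNge (leq_bigmax_seq (F := fun x => len x)).
Qed.

Lemma ray_component u g (K : {fset G}) n : ultra_ray u g -> (forall x, x \in K -> len x < n) ->
  connected_off S K (u n) (u n) /\ infinite_set (connected_off S K (u n)).
Proof.
move=> [ul ud _] Kn.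
have con m : connected_off S K (u n) (u (n + m)).
  elim: m => [|m [p up [lp pK]]].
    rewrite addn0; exists [::] => //; split=> // x; rewrite inE => /eqP ->.
    by apply/negP => /Kn; rewrite ul ltnn.
  exists (rcons p (u (n + m.+1))).
    rewrite rcons_path up /= lp; apply: d1_cayley_adj.
    have := ud (n + m); rewrite addnS => le.
    have := wdist_tri genS (u (n + m)) 1%g (u (n + m).+1); rewrite !(wdist1g S) !ul; lia.
  split; first by rewrite last_rcons.
  move=> x; rewrite -rcons_cons mem_rcons inE => /orP[/eqP ->|]; last exact: pK.
  by apply/negP => /Kn; rewrite ul; lia.
split; first by have := con 0; rewrite addn0.
by apply: unbounded_infinite => m; exists (u (n + m)); rewrite // ul; lia.
Qed.

(** In a finite boundary the class [xi] of a ray [u] would be isolated. Pointing toward [u] would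
    then be unchanged along edges outside some ball, so no path outside it could join [u] to an
    opposite ray, against one-endedness. *)
Lemma boundary_infinite : one_ended S -> forall s : seq bd, exists q, q \notin s.
Proof.
move=> oneS s; apply: contrapT => allq.
have {}allq q : q \in s by apply: contrapT => qs; apply: allq; exists q; apply/negP.
have Ginf n : exists x, n <= len x.
  have [C [[_ Cinf] _]] := oneS fset0.
  by have [g _ ng] := infinite_unbounded Cinf n; exists g.
have [u [v [gu [gv [ug vg uv]]]]] := opposite_rays Ginf.
pose xi : bd := bpoint R genS (ray_asymptotic ug).
have [E EP] : exists E, forall q : bd, q <> xi -> exists N, forall i j,
    N <= i -> N <= j -> gp (brep q i) (brep xi j) <= E.
  suff [E EP] : exists E, forall q : bd, q \in s -> q <> xi -> exists N, forall i j,
      N <= i -> N <= j -> gp (brep q i) (brep xi j) <= E.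
    by exists E => q; apply: EP.
  elim: (s) => [|q t [E EP]]; first by exists 0.
  have [->|qxi] := pselect (q = xi).
    by exists E => q'; rewrite inE => /orP[/eqP -> //|]; apply: EP.
  have [E' [N EN]] := bd_neq genS hypS qxi.
  exists (maxn E E') => q'; rewrite inE => /orP[/eqP -> _|q't /(EP _ q't)[M MP]].
    by exists N => i j Ni Nj; rewrite leq_max EN ?orbT.
  by exists M => i j Mi Mj; rewrite leq_max MP.
(* Beyond the bound [E] for the other boundary points, with room for the hyperbolicity losses and
   for the change of the product along one edge. *)
pose r := E + 10 * delta + 3.
pose toward x := r <= gp x (u r).
have uE M : exists N, forall i j, N <= i -> N <= j -> M <= gp (brep xi i) (u j).
  exact: brep_bpoint.
(* Otherwise edges that leave the set [toward] occur arbitrarily far out, and their starting points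
   have a limit [eta]. *)
have [R0 R0P] : exists R0, forall x y, d x y <= 1 -> R0 <= len x -> toward x -> toward y.
  apply: contrapT => H.
  have {H} : forall k, exists q : G * G,
      [/\ d q.1 q.2 <= 1, k <= len q.1, toward q.1 & ~ toward q.2].
    move=> k; apply: contrapT => H'; apply: H; exists k => x y xy kx tx.
    by apply: contrapT => ty; apply: H'; exists (x, y).
  case/choice=> q qP.
  have [|w wg] := @ultra_ray_exists (fun k => (q k).1).
    by move=> N; apply: filterS (U_oo N) => k /= Nk; case: (qP k) => _ kq _ _; lia.
  have [_ _ wgp] := wg; have [ul _ ugp] := ug.
  pose eta : bd := bpoint R genS (ray_asymptotic wg).
  have wE M : exists N, forall i j, N <= i -> N <= j -> M <= gp (brep eta i) (w j).
    exact: brep_bpoint.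
  have [N1 P1] := uE (10 * r); have [N2 P2] := wE (10 * r).
  (* If [eta = xi], the starting point has product almost [2 * r] with [u r], so its neighbour still
     points toward [u]. If not, the bound [E] shows that the starting point itself does not. *)
  have [etaxi|/EP[N3 P3]] := pselect (eta = xi).
    pose i := N1 + N2 + r; have [k /= wi] := filter_ex (wgp i).
    have [dq _ _] := qP k; apply.
    have := P1 i i; have := P2 i i; rewrite etaxi => /(_ _ _).
    have iN1 : N1 <= i by rewrite /i; lia.
    have iN2 : N2 <= i by rewrite /i; lia.
    move=> /(_ iN2 iN2) wx /(_ iN1 iN1) xu.
    have uu := @ray_gprod u gu i r ug.
    have h1 := hyp4 hypS 1%g (w i) (u r) (brep xi i) (u i).
    have h2 := hypS 1%g (q k).1 (u r) (w i).
    rewrite /toward; move: wi h1 h2 wx.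
    have := gprodC genS 1%g (w i) (brep xi i); have := gprodC genS 1%g (w i) (q k).1.
    have : gp (q k).1 (u r) <= gp (q k).2 (u r) + 2.
      have := gprodE genS 1%g (q k).1 (u r); have := gprodE genS 1%g (q k).2 (u r).
      have := wdist_tri genS (q k).2 1%g (q k).1; have := wdist_tri genS (q k).1 (q k).2 (u r).
      by rewrite (wdistC genS (q k).2 (q k).1); lia.
    by move: uu xu; rewrite /i /r; lia.
  pose i := N1 + N2 + N3 + 10 * r; have [k /= wi] := filter_ex (wgp i).
  have [_ _ tq _] := qP k.
  have iN1 : N1 <= i by rewrite /i; lia.
  have iN2 : N2 <= i by rewrite /i; lia.
  have iN3 : N3 <= i by rewrite /i; lia.
  have := P1 i i iN1 iN1; have := P2 i i iN2 iN2; have := P3 i i iN3 iN3.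
  have := @ray_gprod u gu i r ug.
  have := hyp4 hypS 1%g (brep eta i) (u r) (w i) (q k).1.
  have := hyp4 hypS 1%g (brep eta i) (brep xi i) (u r) (u i).
  rewrite (gprodC genS 1%g (u i) (brep xi i)) (gprodC genS 1%g (u r) (u i)).
  by move: tq wi; rewrite /toward /i /r; lia.
have [B BP] := finite_ball genS R0.
pose K := [fset x in B | len x <= R0]%fset; pose n := R0 + r.+1.
have Kn x : x \in K -> len x < n by rewrite !inE /= /n => /andP[_]; lia.
have notK x : x \notin K -> R0 < len x.
  by rewrite !inE /= ltnNge; apply: contra => le; rewrite le BP.
have [ul _ _] := ug; have [vl _ _] := vg.
have [cuu cui] := ray_component ug Kn; have [cvv cvi] := ray_component vg Kn.
have [C [_ CP]] := oneS K.
have uK : u n \notin K by apply/negP => /Kn; rewrite ul ltnn.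
have vK : v n \notin K by apply/negP => /Kn; rewrite vl ltnn.
have eu : C = connected_off S K (u n) by apply: CP; split=> //; exists (u n).
have ev : C = connected_off S K (v n) by apply: CP; split=> //; exists (v n).
have [p path_p [lp pK]] : connected_off S K (u n) (v n) by rewrite -eu ev.
have tu : toward (u n).
  by have := @ray_gprod u gu n r ug; rewrite /toward /n /r; lia.
have : toward (v n).
  rewrite -lp; elim: p (u n) path_p pK tu {lp cuu cui uK eu} => //= y p IHp x.
  case/andP=> /cayley_adj_d xy py pK tx; apply: IHp => //.
    by move=> z zp; apply: pK; rewrite inE zp orbT.
  by apply: R0P xy _ tx; apply/ltnW/notK/pK; rewrite mem_head.
by rewrite /toward (gprodC genS); have := uv r n; rewrite /r; lia.
Qed.

End UltraLimits.

Lemma free_ultrafilter : exists2 U : set_system nat,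
  UltraFilter U & forall N, U [set k | N <= k].
Proof.
have [U [ultraU UP]] := ultraFilterLemma eventually_filter.
by exists U => // N; apply: UP; exists N.
Qed.

Section RigidBoundary.
Variables (R : realType) (G : groupType) (S : {fset G}).
Hypothesis genS : generates S.
Local Notation len := (word_length S).
Local Notation d := (wdist S).
Local Notation gp := (gprod S 1%g).
Variable delta : nat.
Hypothesis hypS : forall w x y z : G,
  (minn (gprod S w x z) (gprod S w z y) <= gprod S w x y + delta)%N.
Local Notation bd := (gromov_boundary (word_dist R S) (1%g : G)).
Hypothesis oneS : one_ended S.
Hypothesis no_cut : forall a b : bd, ~ cut_pair a b.

(** Take terms far out in representatives of three distinct boundary points. *)
Lemma three_directions_exist : exists M, three_directions S M.
Proof.
have [U ultraU U_oo] := free_ultrafilter.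
have bdinf := boundary_infinite genS hypS ultraU U_oo oneS : forall s : seq bd, _.
have [q1 _] := bdinf [::]; have [q2] := bdinf [:: q1]; rewrite inE => /eqP q21.
have [q3] := bdinf [:: q1; q2]; rewrite !in_cons in_nil orbF negb_or => /andP[/eqP q31 /eqP q32].
have [E1 [N1 P1]] := bd_neq genS hypS q21; have [E2 [N2 P2]] := bd_neq genS hypS q31.
have [E3 [N3 P3]] := bd_neq genS hypS q32.
exists (E1 + E2 + E3) => J.
have [M1 L1] := len_to_infty genS (brep_conv genS q1) J.
have [M2 L2] := len_to_infty genS (brep_conv genS q2) J.
have [M3 L3] := len_to_infty genS (brep_conv genS q3) J.
pose i := N1 + N2 + N3 + M1 + M2 + M3.
exists (brep q1 i), (brep q2 i), (brep q3 i); split; split.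
- by apply: L1; rewrite /i; lia.
- by apply: L2; rewrite /i; lia.
- by apply: L3; rewrite /i; lia.
- by rewrite (gprodC genS); apply: leq_trans (P1 i i _ _) _; rewrite /i; lia.
- by rewrite (gprodC genS); apply: leq_trans (P2 i i _ _) _; rewrite /i; lia.
- by rewrite (gprodC genS); apply: leq_trans (P3 i i _ _) _; rewrite /i; lia.
Qed.

(** The form in which the absence of cut pairs is used: a locally constant property on the
    complement of two points is constant there. The open sets that would separate are the points
    with [C] and those without. *)
Lemma boundary_minus2_connected (A B : bd) (C : set bd) : A <> B ->
  (forall p, p <> A -> p <> B -> exists M, forall q,
     (exists N, forall i j, N <= i -> N <= j -> M <= gp (brep p i) (brep q j)) ->
     [/\ q <> A, q <> B & C p <-> C q]) ->
  forall p q, p <> A -> p <> B -> q <> A -> q <> B -> C p -> C q.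
Proof.
move=> AB Cloc p q pA pB qA qB Cp.
have con : connected (~` [set A; B]) by apply: contrapT => H; apply: (no_cut (a := A) (b := B)).
pose X := ~` [set A; B]; have XP x : X x <-> x <> A /\ x <> B.
  by split=> [Xx|[xA xB] [//|//]]; split=> e; apply: Xx; [left|right].
have opn (D : set bd) :
    (forall x, D x <-> X x /\ C x) \/ (forall x, D x <-> X x /\ ~ C x) -> open D.
  case=> DP; apply: (bd_openP genS hypS) => x /DP[/XP[xA xB] Cx].
    have [M MP] := Cloc x xA xB; exists M => y /MP[yA yB Cxy]; apply/DP.
    by split; [exact/XP | exact/Cxy].
  have [M MP] := Cloc x xA xB; exists M => y /MP[yA yB Cxy]; apply/DP.
  by split; [exact/XP | move/Cxy].
suff e : X `&` C = X by have : X q by [exact/XP]; rewrite -e => -[].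
apply: con.
- by exists p; split=> //; exact/XP.
- exists (X `&` C); first by apply: opn; left.
  by rewrite setIA setIid.
- exists (~` (X `&` ~` C)); first by apply: open_closedC; apply: opn; right.
  apply/seteqP; split=> x; first by case=> Xx Cx; split=> // -[_ /(_ Cx)].
  by case=> Xx nx; split=> //; apply: contrapT => Cx; apply: nx.
Qed.

(** * A sequence of pairs of directions that no chain joins *)

Section BadChains.
Variable U : set_system nat.
Hypothesis ultraU : UltraFilter U.
Hypothesis U_oo : forall N, U [set k | N <= k].
Variables (N rho : nat) (a b z z' : nat -> G) (T : nat -> nat) (K : nat -> pred G).
Hypotheses (a_len : forall k, k <= len (a k)) (b_len : forall k, k <= len (b k)).
Hypotheses (z_len : forall k, k <= len (z k)) (z'_len : forall k, k <= len (z' k)).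
Hypotheses (z_ecc : forall k, ecc S 1%g (a k) (b k) (z k) <= rho).
Hypotheses (z'_ecc : forall k, ecc S 1%g (a k) (b k) (z' k) <= rho).
Hypotheses (Kz : forall k, K k (z k)) (Kz' : forall k, K k (z' k)).
Hypothesis KT : forall k x, T k <= len x -> K k x.

Definition joined r k x y := exists s, [/\ path (chain_link S N (a k) (b k)) x s,
  last x s = y & all (fun t => K k t && (ecc S 1%g (a k) (b k) t <= r)) (x :: s)].

Hypothesis not_joined : forall k, ~ joined k k (z k) (z' k).

Lemma chain_link_sym k x y : chain_link S N (a k) (b k) x y = chain_link S N (a k) (b k) y x.
Proof. by rewrite /chain_link andbC (gprodC genS 1%g x y). Qed.

Lemma joined_step r k x y y' : joined r k x y -> chain_link S N (a k) (b k) y y' ->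
  K k y' -> ecc S 1%g (a k) (b k) y' <= r -> joined r k x y'.
Proof.
case=> s [ps ls als] yy' Ky' ey'; exists (rcons s y'); split.
- by rewrite rcons_path ps ls.
- by rewrite last_rcons.
- by rewrite -rcons_cons all_rcons Ky' ey'.
Qed.

Lemma joined_le r r' k x y : r <= r' -> joined r k x y -> joined r' k x y.
Proof.
move=> rr' [s [ps ls als]]; exists s; split=> //.
by apply: sub_all als => t /andP[-> /leq_trans ->].
Qed.

Lemma unbounded_ultra (f : nat -> G) : (forall k, k <= len (f k)) ->
  forall M, U [set k | M <= len (f k)].
Proof. by move=> fk M; apply: filterS (U_oo M) => k /= Mk; apply: leq_trans Mk (fk k). Qed.

Lemma ultra_limit (g : nat -> G) : (forall k, k <= len (g k)) ->
  exists (q : bd) (u : nat -> G), ultra_ray S U u g /\ asymptotic S (brep q) u.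
Proof.
move=> gk; have [u ug] := ultra_ray_exists genS ultraU (unbounded_ultra gk).
exists (bpoint R genS (ray_asymptotic genS hypS ultraU ug)), u; split=> //.
exact: brep_bpoint.
Qed.

Lemma limit_neq (g h : nat -> G) (q q' : bd) u v E :
  ultra_ray S U u g -> ultra_ray S U v h -> asymptotic S (brep q) u ->
  asymptotic S (brep q') v -> (forall k, gp (g k) (h k) <= E) -> q <> q'.
Proof.
move=> ug vh qu qv ghE e; subst q'.
have /(_ (E + 2 * delta).+1)[i0 /(_ i0 i0 (leqnn _) (leqnn _))] :=
  asymptotic_trans hypS (asymptotic_sym genS qu) qv.
have := ultra_gprod genS hypS ultraU ug vh (E := E) _ i0 i0.
by rewrite ltnNge => -> //; apply: filterS (U_oo 0) => k _; exact: ghE.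
Qed.

Lemma limit_bound (g : nat -> G) (q q' : bd) u : ultra_ray S U u g ->
  asymptotic S (brep q) u -> q' <> q ->
  exists E J, U [set k | forall i, J <= i -> gp (brep q' i) (g k) <= E].
Proof.
move=> ug qu q'q; have [E [J EJ]] := bd_neq genS hypS q'q.
have [J' P'] := qu (E + 2 * delta).+1.
pose j := J + J' + E + 2 * delta + 1.
have [_ _ ugp] := ug.
exists (E + 2 * delta), J; apply: filterS (ugp j) => k /= ujk i Ji.
have := EJ i j Ji; have := P' j j.
have := hyp4 hypS 1%g (brep q' i) (brep q j) (g k) (u j).
have := gprodC genS 1%g (g k) (u j); have := gprodC genS 1%g (brep q j) (u j).
by move: ujk; rewrite /j; lia.
Qed.

Lemma limit_close (g : nat -> G) (q : bd) u M : ultra_ray S U u g ->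
  asymptotic S (brep q) u -> exists J, U [set k | forall i, J <= i -> M <= gp (brep q i) (g k)].
Proof.
move=> [_ _ ugp] qu; have [J JP] := qu (M + delta); pose j := J + M + delta.
exists J; apply: filterS (ugp j) => k /= ujk i Ji.
by have := JP i j Ji; have := hypS 1%g (brep q i) (g k) (u j); move: ujk; rewrite /j; lia.
Qed.

(** Let [C] be the set of boundary points that chains from [z k] reach, for almost all [k], with a
    bound [r] independent of [k]. Away from the limits of [a] and [b] it is locally constant, so it
    contains the limit of [z'] along with that of [z]. For large [k] the bound [r] is exceeded by
    [k], and the chain contradicts [not_joined]. *)
Lemma bad_chains_false : False.
Proof.
have [qa [ua [aR qaR]]] := ultra_limit a_len; have [qb [ub [bR qbR]]] := ultra_limit b_len.
have [qz [uz [zR qzR]]] := ultra_limit z_len.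
have [qz' [uz' [z'R qz'R]]] := ultra_limit z'_len.
have eccP k x r : ecc S 1%g (a k) (b k) x <= r -> gp x (a k) <= r /\ gp x (b k) <= r.
  by rewrite geq_max => /andP.
have za : qz <> qa by apply: (limit_neq (E := rho) zR aR qzR qaR) => k; case/eccP: (z_ecc k).
have zb : qz <> qb by apply: (limit_neq (E := rho) zR bR qzR qbR) => k; case/eccP: (z_ecc k).
have z'a : qz' <> qa by apply: (limit_neq (E := rho) z'R aR qz'R qaR) => k; case/eccP: (z'_ecc k).
have z'b : qz' <> qb by apply: (limit_neq (E := rho) z'R bR qz'R qbR) => k; case/eccP: (z'_ecc k).
(* When [a] and [b] have the same limit, a second point to remove is taken at random among the
   infinitely many others. *)
have [B [AB Bb zB z'B]] : exists B, [/\ qa <> B, qb = qa \/ qb = B, qz <> B & qz' <> B].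
  have [e|ab] := pselect (qa = qb); last by exists qb; split=> //; right.
  have [B] := boundary_infinite genS hypS ultraU U_oo oneS ([:: qa; qz; qz'] : seq bd).
  move=> Bn; have nB q : q \in [:: qa; qz; qz'] -> q <> B.
    by move=> qs e'; move: Bn; rewrite -e' qs.
  by exists B; split; [|left| |]; rewrite //; apply: nB; rewrite !in_cons eqxx ?orbT.
(* The index [J] may depend on [k], because [K k] does; the bound [r] may not. *)
pose C (q : bd) := exists r, U [set k | exists J, forall i, J <= i -> joined r k (z k) (brep q i)].
have far (q : bd) : forall k, exists J, forall i, J <= i -> K k (brep q i).
  move=> k; have [J JP] := len_to_infty genS (brep_conv genS q) (T k).
  by exists J => i /JP; apply: KT.
have eccE (q : bd) : q <> qa -> q <> B -> exists E J, U [set k | forall i, J <= i ->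
    ecc S 1%g (a k) (b k) (brep q i) <= E].
  move=> qna qnB; have qnb : q <> qb by case: Bb => ->.
  have [E1 [J1 P1]] := limit_bound aR qaR qna; have [E2 [J2 P2]] := limit_bound bR qbR qnb.
  exists (E1 + E2), (J1 + J2); apply: filterS (filterI P1 P2) => k /= [k1 k2] i Ji.
  by rewrite geq_max; have := k1 i; have := k2 i; lia.
have linkP k x y r M : ecc S 1%g (a k) (b k) x <= r -> M <= gp x y ->
    2 * (r + delta) + N + r + delta < M ->
    chain_link S N (a k) (b k) x y /\ ecc S 1%g (a k) (b k) y <= r + delta.
  move=> xr Mxy rM; have [xa xb] := eccP _ _ _ xr.
  have ey : ecc S 1%g (a k) (b k) y <= r + delta.
    rewrite geq_max; have := hypS 1%g x (a k) y; have := hypS 1%g x (b k) y; lia.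
  by split=> //; rewrite /chain_link; move: xr ey; rewrite /ecc; lia.
have step (p q : bd) r E J M J' :
    U [set k | forall i, J <= i -> ecc S 1%g (a k) (b k) (brep p i) <= E] ->
    2 * (E + delta) + N + E + delta < M ->
    (forall i j, J' <= i -> J' <= j -> M <= gp (brep p i) (brep q j)) ->
    U [set k | exists J, forall i, J <= i -> joined r k (z k) (brep p i)] ->
    U [set k | exists J, forall i, J <= i -> joined (r + E + delta) k (z k) (brep q i)].
  move=> Ep EM pq Cp; apply: filterS (filterI Ep Cp) => k /= [pE [J1 P1]].
  have [J2 P2] := far q k; exists (J + J' + J1 + J2) => i Ji.
  have [|||lk eq] := @linkP k (brep p i) (brep q i) E M.
  - by apply: pE; lia. - by apply: pq; lia. - by [].
  apply: joined_step (joined_le (r' := r + E + delta) _ (P1 i _)) lk _ _; try lia.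
  by apply: P2; lia.
have Cz : C qz.
  have [J P] := limit_close (2 * (rho + delta) + N + rho + delta + 1) zR qzR.
  exists (rho + delta); apply: filterS P => k /= P; have [J1 P1] := far qz k.
  exists (J + J1) => i Ji.
  have [|||lk ei] := @linkP k (z k) (brep qz i) rho (2 * (rho + delta) + N + rho + delta + 1).
  - exact: z_ecc. - by rewrite (gprodC genS); apply: P; lia. - by lia.
  exists [:: brep qz i]; rewrite /= lk Kz ei P1 ?(leq_trans (z_ecc k)) //; lia.
have : C qz'.
  apply: (boundary_minus2_connected AB _ za zB z'a z'B Cz) => p pa pB.
  have [E [J EJ]] := eccE p pa pB.
  have [EA [NA PA]] := bd_neq genS hypS pa; have [EB [NB PB]] := bd_neq genS hypS pB.
  pose M := 2 * (E + 2 * delta) + N + E + 2 * delta + EA + EB + 1.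
  exists M => q [J' pq]; split.
  - move=> e; subst q; have := PA (NA + J') (NA + J'); have := pq (NA + J') (NA + J').
    by rewrite /M; lia.
  - move=> e; subst q; have := PB (NB + J') (NB + J'); have := pq (NB + J') (NB + J').
    by rewrite /M; lia.
  split=> -[r Cr].
    by exists (r + E + delta); apply: step EJ _ pq Cr; rewrite /M; lia.
  (* The same step with [p] and [q] exchanged: by [linkP] the terms of [q] satisfy the bound of [p]
     up to [delta]. *)
  exists (r + (E + delta) + delta).
  apply: (@step q p r (E + delta) (J + J') M J') => //; last 2 first.
  - by rewrite /M; lia.
  - by move=> i j Ji Jj; rewrite (gprodC genS) pq.
  apply: filterS EJ => k /= EJ i Ji.
  have [|||_ //] := @linkP k (brep p i) (brep q i) E M.
  - by apply: EJ; lia. - by apply: pq; lia. - by rewrite /M; lia.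
case=> r Cr.
have [J P] := limit_close (2 * (rho + delta) + N + rho + delta + 1) z'R qz'R.
have [k /= [[rk [J1 P1]] P2]] := filter_ex (filterI (filterI (U_oo (r + rho + delta)) Cr) P).
apply: (@not_joined k); pose i := J + J1.
have iJ : J <= i by rewrite /i; lia. have iJ1 : J1 <= i by rewrite /i; lia.
have [|||lk ei] := @linkP k (z' k) (brep qz' i) rho (2 * (rho + delta) + N + rho + delta + 1).
- exact: z'_ecc. - by rewrite (gprodC genS); apply: P2. - by lia.
apply: joined_step (joined_le (r' := k) _ (P1 i iJ1)) _ (Kz' k) _.
- by lia.
- by rewrite chain_link_sym.
- by apply: leq_trans (z'_ecc k) _; lia.
Qed.

End BadChains.

(** If no constants worked, each [k], taken both as [rho'] and as [R0], would have a counterexample.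
    It comes with its own [T] and [K], which is why the constants obtained do not depend on them. *)
Lemma chain_connected_exists N rho :
  exists rho' R0, rho <= rho' /\ chain_connected S N rho rho' R0.
Proof.
suff [k kP] : exists k, chain_connected S N rho k k.
  exists (maxn rho k), k; split; first exact: leq_maxl.
  move=> a b z z' ka kb kz kz' ez ez' T K Kz Kz' KT.
  have [s [ps ls als]] := kP a b z z' ka kb kz kz' ez ez' T K Kz Kz' KT.
  exists s; split=> //; apply: sub_all als => t /andP[-> /leq_trans ->] //.
  exact: leq_maxr.
apply: contrapT => H.
have {H} : forall k, exists q : (G * G) * (G * G) * (nat * pred G),
    let: (a, b, (z, z'), (T, K)) := q in
    [/\ [/\ k <= len a, k <= len b, k <= len z & k <= len z'],
        ecc S 1%g a b z <= rho /\ ecc S 1%g a b z' <= rho,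
        K z /\ K z', forall x, T <= len x -> K x &
        ~ exists s, [/\ path (chain_link S N a b) z s, last z s = z' &
                all (fun x => K x && (ecc S 1%g a b x <= k)) (z :: s)]].
  move=> k; apply: contrapT => H'; apply: H; exists k.
  move=> a b z z' ka kb kz kz' ez ez' T K Kz Kz' KT; apply: contrapT => H.
  by apply: H'; exists (a, b, (z, z'), (T, K)).
case/choice=> q qP; have [U ultraU U_oo] := free_ultrafilter.
apply: (@bad_chains_false U ultraU U_oo N rho (fun k => (q k).1.1.1) (fun k => (q k).1.1.2)
  (fun k => (q k).1.2.1) (fun k => (q k).1.2.2) (fun k => (q k).2.1) (fun k => (q k).2.2)) => k;
  rewrite ?/joined /=;
  by case: (q k) (qP k) => [[[a b] [z z']] [T K]] [[? ? ? ?] [? ?] [? ?] ? ?].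
Qed.

End RigidBoundary.

(** * Filling edge loops *)

Section RealizationTopology.
Variables (R : realType) (V : choiceType) (Z : simplicial_complex V).
Local Open Scope ring_scope.
Local Notation X := (realization R Z).
Implicit Types (x y : X) (v : V) (s W : {fset V}).

Lemma coord_ge0 x v : 0 <= x v.
Proof. by case: (coordP x) => s _ []. Qed.

Lemma realizationP x y : (forall v, x v = y v) -> x = y.
Proof.
case: x y => [x xP] [y yP] /= /funext e; subst y.
by rewrite (Prop_irrelevance xP yP).
Qed.

Lemma closed_simplexE s x : closed_simplex s x <-> forall v, v \notin s -> x v = 0.
Proof.
split=> [[]//|xs]; split=> // [v|]; first exact: coord_ge0.
have [s0 _ [_ x0 x1]] := coordP x.
rewrite -x1; pose u := (s `|` s0)%fset.
rewrite (@big_fset_incl _ _ _ _ s u) ?fsubsetUl //; last by move=> v _ /xs.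
by rewrite [RHS](@big_fset_incl _ _ _ _ s0 u) ?fsubsetUr //; move=> v _ /x0.
Qed.

Lemma coord_pos_exists x : exists v, 0 < x v.
Proof.
have [s _ [x0 _ x1]] := coordP x; apply: contrapT => H.
have : \sum_(v <- s) x v <= 0.
  apply: sumr_le0 => v _; rewrite leNgt; apply/negP => xv.
  by apply: H; exists v.
by rewrite x1 ler10.
Qed.

Lemma star_simplex x W : W != fset0 -> (forall v, v \in W -> 0 < x v) -> simplex Z W.
Proof.
move=> W0 xW; have [s Zs [_ x0 _]] := coordP x.
apply: (simplex_face Zs _ W0); apply/fsubsetP => v vW.
by apply: contraT => /x0 e; have := xW v vW; rewrite e ltxx.
Qed.

Lemma realization_openE (U : set X) : open U = realization_open U.
Proof. by []. Qed.

Lemma open_star v : open [set x : X | 0 < x v].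
Proof.
rewrite realization_openE => s Zs x /= xv sx; exists (x v) => // y sy.
have vs : v \in s.
  by apply: contraT => vs; case: sx => _ /(_ v vs) e _; rewrite e ltxx in xv.
move=> /(_ v vs); rewrite ltr_norml => /andP[]; lra.
Qed.

(** In the weak topology a neighbourhood is prescribed simplex by simplex. With support in [W] only
    finitely many simplices matter, and a simplex that does not contain [f t] is avoided nearby,
    since some coordinate outside it stays positive. *)
Lemma continuous_realization (T : topologicalType) (f : T -> X) W :
  (forall t v, v \notin W -> f t v = 0) ->
  (forall v, continuous (fun t => f t v)) -> continuous f.
Proof.
move=> fW fc t A; rewrite nbhsE; case=> O [oO Oft] OA.
suff : \forall t' \near t, O (f t') by apply: filterS => t' /OA.
have near_s s : s \in fpowerset W -> nbhs t
    [set t' | simplex Z s -> closed_simplex s (f t') -> O (f t')].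
  move=> _; have [Zs|nZs] := pselect (simplex Z s); last by apply: nearW => t' /nZs.
  have [sft|nsft] := pselect (closed_simplex s (f t)).
    have [e e0 eO] := oO s Zs (f t) Oft sft.
    have : nbhs t (\bigcap_(v in [set` s]) [set t' | `|f t' v - f t v| < e]).
      by apply: filter_bigI => v _; exact: cvgr_distC_lt (fc v t) _ e0.
    by apply: filterS => t' t'e _ st'; apply: eO => // v vs; exact: t'e.
  have [v vs fv] : exists2 v, v \notin s & 0 < f t v.
    apply: contrapT => H; apply/nsft/closed_simplexE => v vs; apply/eqP.
    rewrite eq_le coord_ge0 andbT leNgt; apply/negP => fv.
    by apply: H; exists v.
  have : \forall t' \near t, 0 < f t' v by exact: cvgr_gt (fc v t) _ fv.
  apply: filterS => t' fv' _ /closed_simplexE/(_ v vs) e.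
  by rewrite e ltxx in fv'.
have := filter_bigI (nbhs_filter t) near_s; apply: filterS => t' t'P.
pose s := [fset v in W | 0 < f t' v]%fset.
have fs v : v \notin s -> f t' v = 0.
  rewrite !inE /= negb_and => /orP[/fW //|].
  by rewrite -leNgt => le; apply/eqP; rewrite eq_le coord_ge0 le.
apply: (t'P s).
- by rewrite /= fpowersetE; apply/fsubsetP => v; rewrite !inE => /andP[].
- have [v fv] := coord_pos_exists (f t'); apply: (star_simplex (x := f t')).
    apply/fset0Pn; exists v; apply: contraT => /fs e.
    by rewrite e ltxx in fv.
  by move=> w; rewrite !inE => /andP[].
- by apply/closed_simplexE.
Qed.

End RealizationTopology.

Section Grid.
Variables (R : realType) (V : choiceType) (Z : simplicial_complex V).
Local Open Scope ring_scope.
Local Notation X := (realization R Z).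
Local Notation I := (`[0, 1]%classic : set R).

(** A Lebesgue number for the cover by open stars: bad squares of arbitrarily small mesh would
    accumulate at a point of the square, near which [H] stays in one star. *)
Lemma star_grid (H : R * R -> X) : {within I `*` I, continuous H} ->
  exists n0, forall m i j, (n0 <= m)%N -> (i < m)%N -> (j < m)%N ->
    exists v, forall s t, i%:R / m%:R <= s <= i.+1%:R / m%:R ->
      j%:R / m%:R <= t <= j.+1%:R / m%:R -> 0 < H (s, t) v.
Proof.
move=> /subspace_continuousP Hc; apply: contrapT => nH.
have {nH} : forall n, exists q : nat * (nat * nat),
    [/\ (n <= q.1)%N, (q.2.1 < q.1)%N, (q.2.2 < q.1)%N &
     ~ exists v, forall s t, q.2.1%:R / q.1%:R <= s <= q.2.1.+1%:R / q.1%:R ->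
      q.2.2%:R / q.1%:R <= t <= q.2.2.+1%:R / q.1%:R -> 0 < H (s, t) v].
  move=> n; apply: contrapT => nq; apply: nH; exists n => m i j nm im jm.
  by apply: contrapT => nv; apply: nq; exists (m, (i, j)).
case/choice => q qP.
pose p n : R * R := ((q n).2.1%:R / (q n).1%:R, (q n).2.2%:R / (q n).1%:R).
have pI n : (I `*` I) (p n).
  have [_ im jm _] := qP n.
  have m0 : (0 : R) < (q n).1%:R by rewrite ltr0n; lia.
  by split; rewrite /= in_itv /= divr_ge0 //= ler_pdivrMr // mul1r ler_nat ltnW.
have pF : ProperFilter (p @ \oo) by apply: fmap_proper_filter.
have cI := @segment_compact R 0 1.
have [|[x y] /= [[Ix Iy] pxy]] := compact_setX cI cI pF.
  by exists 0%N => // n _; apply: pI.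
have [v xyv] := coord_pos_exists (H (x, y)).
have : nbhs (H (x, y)) [set z : X | 0 < z v].
  by apply: open_nbhs_nbhs; split=> //; exact: open_star.
move=> /(Hc (x, y) (conj Ix Iy)) /nbhs_ballP[e /= e0 eH].
pose n := (Num.bound (2 / e)).+1.
have [z [[k /= nk zk] zB]] : [set z | exists2 k, (n <= k)%N & z = p k] `&`
    ball (x, y) (e / 2) !=set0.
  apply: pxy; last by apply: nbhsx_ballx; rewrite divr_gt0.
  by exists n => // k /= nk; exists k.
have [km ikm jkm] := qP k; apply; exists v => s t.
move: zB; rewrite zk /p; case; rewrite /ball /= /ball_ /=.
set m := (q k).1; set i := (q k).2.1; set j := (q k).2.2.
have m0 : (0 : R) < m%:R by rewrite ltr0n /m; lia.
have me : m%:R^-1 < e / 2.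
  rewrite invf_plt ?posrE ?divr_gt0 // invf_div.
  apply: lt_le_trans (archi_boundP _) _; first by rewrite divr_ge0 ?ltW.
  by rewrite ler_nat /m; apply: leq_trans km; apply: leq_trans nk; rewrite /n.
have eE : e = e / 2 + e / 2 by lra.
set e' := e / 2 in me eE *.
rewrite !ltr_norml -!natr1 !mulrDl !mul1r => /andP[x1 x2] /andP[y1 y2].
move=> /andP[s1 s2] /andP[t1 t2].
have ij r : (r < m)%N -> 0 <= (r%:R : R) / m%:R /\ (r%:R : R) / m%:R + m%:R^-1 <= 1.
  move=> rm; split; first by rewrite divr_ge0.
  by rewrite -[X in _ + X]mul1r -mulrDl ler_pdivrMr // mul1r natr1 ler_nat.
have [i0 i1] := ij i ikm; have [j0 j1] := ij j jkm.
apply: eH; last by split; rewrite /= in_itv /=; apply/andP; split; lra.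
by split; rewrite /ball /= /ball_ /= ltr_norml; apply/andP; split; lra.
Qed.

End Grid.

Section EdgePaths.
Variables (R : realType) (V : choiceType) (Z : simplicial_complex V).
Local Open Scope ring_scope.
Local Notation X := (realization R Z).
Local Notation I := (`[0, 1]%classic : set R).

Definition edge u v : bool := `[< simplex Z [fset u; v]%fset >].

Lemma vertex_point_subproof v :
  exists2 s, simplex Z s & closed_simplex s (fun w => (w == v)%:R : R).
Proof.
exists [fset v]%fset; first exact: simplex_vertex.
split=> [w|w|]; first by rewrite ler0n.
  by rewrite inE => /negbTE ->.
by rewrite big_seq_fset1 eqxx.
Qed.

Definition vertex_point v : X := Realization (vertex_point_subproof v).

Lemma vertex_point_star v w : 0 < vertex_point v w -> w = v.
Proof. by rewrite /= ltr0n lt0b => /eqP. Qed.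

Lemma star_edge (x : X) u v : 0 < x u -> 0 < x v -> edge u v.
Proof.
move=> xu xv; apply/asboolP; apply: (star_simplex (x := x)).
  by apply/fset0Pn; exists u; rewrite !inE eqxx.
by move=> w; rewrite !inE => /orP[] /eqP ->.
Qed.

Lemma edge_connected : simply_connected R X ->
  forall u v, exists p, path edge u p /\ last u p = v.
Proof.
move=> [[_ pc] _] u v; have [f [fc f0 f1]] := pc (vertex_point u) (vertex_point v).
(* The path is viewed as a homotopy that is constant in its first variable. Consecutive stars then
   share the image of a subdivision point, so that their centers span an edge. *)
have [|n0 n0P] := @star_grid R V Z (fun q => f q.2).
  apply/subspace_continuousP => -[s t] /= [Is It] A fA.
  have /subspace_continuousP/(_ t It A fA) := fc.
  rewrite /within /= /fmap /= => /nbhs_ballP[e /= e0 eP].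
  by apply/nbhs_ballP; exists e => // -[s' t'] /= [_ tt'] [_ It']; exact: eP.
pose m := n0.+1; have m0 : (0 : R) < m%:R by rewrite ltr0n.
have wP j : exists w, (j < m)%N -> forall t : R, j%:R / m%:R <= t <= j.+1%:R / m%:R -> 0 < f t w.
  have [jm|] := boolP (j < m)%N; last by exists u.
  have [w wP] := n0P m 0%N j (leqnSn _) (ltn0Sn _) jm; exists w => _ t tj.
  apply: (wP 0) => //; rewrite mul0r lexx divr_ge0 //.
have [w {}wP] := choice wP.
have w0 : w 0%N = u.
  by apply: vertex_point_star; rewrite -f0; apply: wP; rewrite // mul0r lexx divr_ge0.
have wm : w n0 = v.
  apply: vertex_point_star; rewrite -f1; apply: wP; first by [].
  by rewrite divff ?gt_eqF // lexx andbT ler_pdivrMr // mul1r ler_nat.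
have con k : (k < m)%N -> path edge (w 0%N) [seq w j | j <- iota 1 k] /\
    last (w 0%N) [seq w j | j <- iota 1 k] = w k.
  elim: k => // k IHk km; have [pk lk] := IHk (ltnW km).
  have -> : iota 1 k.+1 = iota 1 k ++ [:: k.+1] by rewrite -(addn1 k) iotaD add1n addn1.
  rewrite map_cat cat_path last_cat pk lk /= andbT; split=> //.
  apply: (star_edge (x := f (k.+1%:R / m%:R))); apply: wP => //; try exact: ltnW.
    by rewrite lexx andbT ler_pM2r ?invr_gt0 // ler_nat.
  by rewrite lexx /= ler_pM2r ?invr_gt0 // ler_nat.
by have [pk lk] := con n0 (ltnSn _); exists [seq w j | j <- iota 1 n0]; rewrite -w0 -wm.
Qed.

Definition hat (x : R) := Num.max 0 (1 - `|x|).

Lemma hat_eq0 x : 1 <= `|x| -> hat x = 0.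
Proof. by move=> x1; rewrite /hat max_l // subr_le0. Qed.

Lemma hat_ge0 x : 0 <= hat x. Proof. by rewrite le_max lexx. Qed.

Section PolygonalLoop.
Variables (w : nat -> V) (m : nat).
Hypothesis wE : forall i, (i < m)%N -> edge (w i) (w i.+1).

(** Barycentric coordinates of the piecewise linear path that is at [w i] at time [i]. Written as a
    sum of tent functions, it is continuous in each coordinate at sight. *)
Definition polygon (x : R) v := \sum_(i < m.+1) (w i == v)%:R * hat (x - i%:R).

Lemma hat_outside (x : R) e i : e%:R <= x <= e.+1%:R -> i != e -> i != e.+1 -> hat (x - i%:R) = 0.
Proof.
move=> /andP[ex xe] ie ie1; apply: hat_eq0; rewrite -natr1 in xe.
have [lt|le] := ltnP i e.
  have : (i.+1%:R : R) <= e%:R by rewrite ler_nat.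
  by rewrite -natr1 => h; rewrite ger0_norm; lra.
have : (e.+2%:R : R) <= i%:R by rewrite ler_nat; lia.
by rewrite -!natr1 => h; rewrite ler0_norm; lra.
Qed.

Lemma hat_sum (x : R) e : e%:R <= x <= e.+1%:R -> hat (x - e%:R) + hat (x - e.+1%:R) = 1.
Proof.
rewrite -natr1 => /andP[ex xe]; rewrite /hat ger0_norm ?ler0_norm; try lra.
by rewrite !max_r; lra.
Qed.

Lemma polygonE (x : R) e v : (e < m)%N -> e%:R <= x <= e.+1%:R ->
  polygon x v = (w e == v)%:R * hat (x - e%:R) + (w e.+1 == v)%:R * hat (x - e.+1%:R).
Proof.
move=> em ex; have e1 : (e < m.+1)%N by lia. have e2 : (e.+1 < m.+1)%N by lia.
rewrite /polygon (bigD1 (Ordinal e1)) //= (bigD1 (Ordinal e2)) /=; last first.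
  by apply/eqP => /(congr1 val) /=; lia.
rewrite big1 ?addr0 // => i /andP[ie1 ie2].
by rewrite (hat_outside ex) ?mulr0 //; apply: contra ie1 || apply: contra ie2;
  move=> /eqP h; apply/eqP/val_inj.
Qed.

(** Extends the path constantly outside [[0, 1]], so that it is a map to the realization defined and
    continuous on the whole line. *)
Definition clamp (t : R) := Num.max 0 (Num.min 1 t).

Lemma clamp01 t : 0 <= clamp t <= 1.
Proof. by rewrite /clamp le_max lexx /= ge_max ler01 ge_min lexx. Qed.

Lemma clampE t : 0 <= t <= 1 -> clamp t = t.
Proof. by case/andP=> t0 t1; rewrite /clamp min_r // max_r. Qed.

Hypothesis m_gt0 : (0 < m)%N.

Lemma polygon_block (x : R) : 0 <= x <= m%:R -> exists2 e, (e < m)%N & e%:R <= x <= e.+1%:R.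
Proof.
case/andP=> x0 xm; have /andP[tx xt] := truncn_itv x0.
have [lt|le] := ltnP (Num.trunc x) m; first by exists (Num.trunc x) => //; rewrite tx ltW.
exists m.-1; first by rewrite prednK.
rewrite prednK // xm andbT; apply: le_trans tx.
by rewrite ler_nat; lia.
Qed.

Lemma polygon_subproof t : exists2 s, simplex Z s & closed_simplex s (polygon (m%:R * clamp t)).
Proof.
have [|e em ex] := @polygon_block (m%:R * clamp t).
  have /andP[c0 c1] := clamp01 t.
  by rewrite mulr_ge0 //= -[leRHS]mulr1 ler_pM2l ?ltr0n.
set x := m%:R * clamp t in ex *.
exists [fset w e; w e.+1]%fset; first exact/asboolP/wE.
split=> [v|v|].
- by apply: sumr_ge0 => i _; rewrite mulr_ge0 ?hat_ge0.
- rewrite !inE negb_or => /andP[v1 v2]; rewrite (polygonE v em ex).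
  by rewrite eq_sym (negbTE v1) eq_sym (negbTE v2) !mul0r addr0.
under eq_bigr do rewrite (polygonE _ em ex).
rewrite big_split /= -!mulr_suml.
have sum1 u : u \in [fset w e; w e.+1]%fset ->
    \sum_(v <- [fset w e; w e.+1]%fset) (u == v)%:R = 1 :> R.
  move=> us; rewrite (bigD1_seq u) //= eqxx big1 ?addr0 // => v.
  by rewrite eq_sym => /negbTE ->.
by rewrite !sum1 ?mul1r ?(hat_sum ex) // !inE eqxx ?orbT.
Qed.

Definition polygon_path t : X := Realization (polygon_subproof t).

Lemma polygon_path_block t e : 0 <= t <= 1 -> (e < m)%N -> e%:R <= m%:R * t <= e.+1%:R ->
  forall v, 0 < polygon_path t v -> v = w e \/ v = w e.+1.
Proof.
move=> t01 em ex v; rewrite /= clampE // (polygonE v em ex).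
case: (eqVneq (w e) v) => [->|_]; first by left.
case: (eqVneq (w e.+1) v) => [->|_]; first by right.
by rewrite !mul0r addr0 ltxx.
Qed.

Lemma polygon_path_vertex t e : 0 <= t <= 1 -> (e <= m)%N -> m%:R * t = e%:R ->
  forall v, 0 < polygon_path t v -> v = w e.
Proof.
move=> t01 em tE v; rewrite /= clampE // tE => pv; apply: contrapT => ve; move: pv.
rewrite /polygon big1 ?ltxx // => i _; case: eqP => [wv|_]; last by rewrite mul0r.
rewrite hat_eq0 ?mulr0 //; case: (ltngtP i e) => [lt|lt|ie]; last by rewrite ie in wv; case: ve.
  have : (i.+1%:R : R) <= e%:R by rewrite ler_nat.
  by rewrite -natr1 => h; rewrite ger0_norm; lra.
have : (e.+1%:R : R) <= i%:R by rewrite ler_nat.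
by rewrite -natr1 => h; rewrite ler0_norm; lra.
Qed.

Lemma polygon_path_continuous : continuous polygon_path.
Proof.
apply: (@continuous_realization _ _ _ _ _ [fset w (val i) | i in 'I_m.+1]%fset) => [t v vW|v].
  rewrite /= /polygon big1 // => i _; case: eqP => [wv|_]; last by rewrite mul0r.
  by case/negP: vW; apply/imfsetP; exists i.
have cc : continuous clamp.
  move=> t; apply: (@continuous_max R R (cst 0) (Num.min 1)); first exact: cst_continuous.
  by apply: (@continuous_min R R (cst 1) id); [exact: cst_continuous | by move=> ?].
have hc : continuous hat.
  move=> t; apply: (@continuous_max R R (cst 0) (fun x => 1 - `|x|)).
    exact: cst_continuous.
  apply: continuousB; first exact: cst_continuous.
  exact: norm_continuous.
rewrite /= /polygon; apply: continuous_big => [|i _]; first exact: add_continuous.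
move=> t; apply: cvgM; first exact: cvg_cst.
apply: (@continuous_comp _ _ _ (fun t => m%:R * clamp t - i%:R) hat); last exact: hc.
by apply: cvgB; [apply: cvgM; [exact: cvg_cst | exact: cc] | exact: cvg_cst].
Qed.

Lemma polygon_path_at t e : 0 <= t <= 1 -> (e <= m)%N -> m%:R * t = e%:R ->
  polygon_path t = vertex_point (w e).
Proof.
move=> t01 em te.
have out v : v \notin [fset w e]%fset -> polygon_path t v = 0.
  rewrite inE => ve; apply/eqP; rewrite eq_le coord_ge0 andbT leNgt; apply: contra ve.
  by move/(polygon_path_vertex t01 em te) => ->.
have /closed_simplexE[_ _] := out; rewrite big_seq_fset1 => we.
apply: realizationP => v; rewrite [RHS]/=.
by case: eqVneq => [->|ve]; [exact: we | rewrite out ?inE].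
Qed.

End PolygonalLoop.

Fixpoint edge_sum (lam : V -> V -> bool) v p :=
  if p is u :: p' then lam v u (+) edge_sum lam u p' else false.

Lemma edge_sum_nth lam v p :
  edge_sum lam v p = \big[addb/false]_(i < size p) lam (nth v (v :: p) i) (nth v (v :: p) i.+1).
Proof.
elim: p v => [|u p IHp] v /=; first by rewrite big_ord0.
rewrite big_ord_recl /= IHp; congr (_ (+) _); apply: eq_bigr => i _ /=.
by congr lam; apply: set_nth_default => //=; rewrite ltnS ltnW.
Qed.

(** Degenerate triples are included: they force [lam u u = false] for [u] in [W], and symmetry on
    edges of [W]. *)
Definition cocycle_on (W : {fset V}) (lam : V -> V -> bool) :=
  forall u v w, u \in W -> v \in W -> w \in W -> simplex Z [fset u; v; w]%fset ->
    lam u v (+) lam v w = lam u w.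

(** Cut a null homotopy into small squares and choose for each a vertex whose star contains its
    image. Vertices of squares with a common corner span a simplex, so the cocycle condition makes
    the sums along successive rows equal. The last row is constant, and the sum along row 0 is that
    of the loop. *)
Lemma loop_filling : simply_connected R X ->
  forall v p, path edge v p -> last v p = v ->
  exists W, forall lam, cocycle_on W lam -> edge_sum lam v p = false.
Proof.
move=> [_ sc] v0 p path_p last_p.
case: (posnP (size p)) => [/size0nil ->|m_gt0]; first by exists fset0.
set m := size p in m_gt0; pose w i := nth v0 (v0 :: p) i.
have wE i : (i < m)%N -> edge (w i) (w i.+1) by move=> im; exact: (pathP v0 path_p).
have wm : w m = v0 by rewrite /w -[RHS]last_p (last_nth v0).
have m0 : (0 : R) < m%:R by rewrite ltr0n.
pose gam := polygon_path wE m_gt0.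
have g0 : gam 0 = vertex_point v0.
  by rewrite /gam (polygon_path_at _ _ (e := 0%N)) ?lexx ?ler01 ?mulr0.
have g1 : gam 1 = vertex_point v0.
  by rewrite -wm /gam (polygon_path_at _ _ (e := m)) ?lexx ?ler01 ?mulr1.
have [H [Hc H0 H1 Hs]] : null_homotopic gam (vertex_point v0).
  by apply: sc; split=> //; apply/continuous_subspaceT/polygon_path_continuous.
have [n0 n0P] := star_grid Hc.
have kk0 k : (k <= k <= k.+1)%N by rewrite leqnn leqnSn.
have kk1 k : (k <= k.+1 <= k.+1)%N by rewrite leqnn leqnSn.
have [M n0M M_gt0] : exists2 M, (n0 <= M)%N & (0 < M)%N by exists n0.+1.
(* A multiple of [m], so that each edge of the loop is cut into exactly [M] columns. *)
have [N NE] : exists N, N = (m * M)%N by exists (m * M)%N.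
have N_gt0 : (0 < N)%N by rewrite NE muln_gt0 m_gt0.
have N0 : (0 : R) < N%:R by rewrite ltr0n.
have n0N : (n0 <= N)%N by rewrite NE; apply: leq_trans (leq_pmull _ m_gt0).
have sqP (q : nat * nat) : exists u, (q.1 < N)%N -> (q.2 < N)%N -> forall s t,
    q.1%:R / N%:R <= s <= q.1.+1%:R / N%:R -> q.2%:R / N%:R <= t <= q.2.+1%:R / N%:R ->
    0 < H (s, t) u.
  have [/andP[q1 q2]|nq] := boolP ((q.1 < N)%N && (q.2 < N)%N).
    by have [u uP] := n0P N q.1 q.2 n0N q1 q2; exists u.
  by exists v0 => q1 q2; rewrite q1 q2 in nq.
have [sq' {}sqP] := choice sqP.
have [sq {}sqP] : exists sq : nat -> nat -> V, forall i j, (i < N)%N -> (j < N)%N -> forall s t,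
    i%:R / N%:R <= s <= i.+1%:R / N%:R -> j%:R / N%:R <= t <= j.+1%:R / N%:R ->
    0 < H (s, t) (sq i j).
  by exists (fun i j => sq' (i, j)) => i j; exact: (sqP (i, j)).
have [g gE] : exists g : nat -> R, forall k, g k = k%:R / N%:R by eexists.
have g_in i k : (i <= k <= i.+1)%N -> i%:R / N%:R <= g k <= i.+1%:R / N%:R.
  by case/andP=> ik ki; rewrite gE !ler_pM2r ?invr_gt0 // !ler_nat ik ki.
have gE0 : g 0%N = 0 by rewrite gE mul0r.
have gN : g N = 1 by rewrite gE divff ?gt_eqF.
have g01 k : (k <= N)%N -> 0 <= g k <= 1.
  by move=> kN; rewrite gE divr_ge0 //= ler_pdivrMr // mul1r ler_nat.
have sqG i j a b : (i < N)%N -> (j < N)%N -> (i <= a <= i.+1)%N -> (j <= b <= j.+1)%N ->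
    0 < H (g a, g b) (sq i j).
  by move=> iN jN ia jb; apply: sqP => //; exact: g_in.
have HL b : (b <= N)%N -> H (g 0%N, g b) = gam (g b) by move=> bN; rewrite gE0 H0 ?g01.
have HR b : (b <= N)%N -> H (g N, g b) = vertex_point v0 by move=> bN; rewrite gN H1 ?g01.
have HB a : (a <= N)%N -> H (g a, g 0%N) = vertex_point v0.
  by move=> aN; rewrite gE0; have [-> _] := Hs (g a) (g01 a aN).
have HT a : (a <= N)%N -> H (g a, g N) = vertex_point v0.
  by move=> aN; rewrite gN; have [_ ->] := Hs (g a) (g01 a aN).
pose W := ([fset sq (val q.1) (val q.2) | q in {: 'I_N * 'I_N}] `|`
           [fset w (val e) | e in 'I_m.+1])%fset.
have sqW i j : (i < N)%N -> (j < N)%N -> sq i j \in W.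
  move=> iN jN; rewrite inE; apply/orP; left.
  by apply/imfsetP; exists (Ordinal iN, Ordinal jN).
have wW e : (e <= m)%N -> w e \in W.
  rewrite -ltnS => em; rewrite inE; apply/orP; right.
  by apply/imfsetP; exists (Ordinal em).
exists W => lam lamW.
have tri (x : X) a b c : a \in W -> b \in W -> c \in W ->
    0 < x a -> 0 < x b -> 0 < x c -> lam a b (+) lam b c = lam a c.
  move=> aW bW cW xa xb xc; apply: lamW => //; apply: (star_simplex (x := x)).
    by apply/fset0Pn; exists a; rewrite !inE eqxx.
  by move=> u; rewrite !inE -orbA => /or3P[] /eqP ->.
have lam0 : lam v0 v0 = false.
  have := @tri (vertex_point v0) v0 v0 v0; rewrite /= eqxx ltr01 -{1 2 3}wm wW // addbb.
  by move=> <-.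
(* A square touching one of the three sides that [H] sends to [v0] has a corner mapped to [v0],
   which lies in no other star. *)
have base i j : (i < N)%N -> (j < N)%N -> (i.+1 == N) || (j == 0%N) || (j.+1 == N) -> sq i j = v0.
  move=> iN jN; case/orP => [/orP[]|] /eqP e; apply: vertex_point_star.
  - by rewrite -(HR j (ltnW jN)); apply: sqG; rewrite // -?e ?kk0 ?kk1.
  - by rewrite -(HB i (ltnW iN)); apply: sqG; rewrite // ?e ?kk0.
  - by rewrite -(HT i (ltnW iN)); apply: sqG; rewrite // -?e ?kk0 ?kk1.
pose row i k := \big[addb/false]_(j < k) lam (sq i j) (sq i j.+1).
have row_step i k : (i.+1 < N)%N -> (k < N)%N ->
    row i k (+) row i.+1 k = lam (sq i 0%N) (sq i.+1 0%N) (+) lam (sq i k) (sq i.+1 k).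
  move=> iN; elim: k => [|k IHk] kN; first by rewrite /row !big_ord0 !addbb.
  rewrite /row !big_ord_recr /= -!/(row _ _).
  have := IHk (ltnW kN).
  have t1 := @tri (H (g i.+1, g k.+1)) (sq i k) (sq i k.+1) (sq i.+1 k.+1).
  have t2 := @tri (H (g i.+1, g k.+1)) (sq i k) (sq i.+1 k) (sq i.+1 k.+1).
  have {}t1 : lam (sq i k) (sq i k.+1) (+) lam (sq i k.+1) (sq i.+1 k.+1) =
      lam (sq i k) (sq i.+1 k.+1).
    by apply: t1; rewrite ?sqW ?sqG ?kk0 ?kk1 // ltnW.
  have {}t2 : lam (sq i k) (sq i.+1 k) (+) lam (sq i.+1 k) (sq i.+1 k.+1) =
      lam (sq i k) (sq i.+1 k.+1).
    by apply: t2; rewrite ?sqW ?sqG ?kk0 ?kk1 // ltnW.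
  move: t1; rewrite -t2; move: (row i k) (row i.+1 k) (lam (sq i k) (sq i k.+1)) => [] [] [];
    move: (lam (sq i 0%N) _) (lam (sq i.+1 k) _) (lam (sq i k.+1) _) (lam (sq i k) _)
      => [] [] [] [] //.
have NP : N.-1.+1 = N by rewrite prednK.
have NP' : (N.-1 < N)%N by rewrite NP.
have row0 i : (i < N)%N -> row 0%N N.-1 = row i N.-1.
  elim: i => // i IHi iN; rewrite IHi ?(ltnW iN) //.
  have := row_step i N.-1 iN NP'; have iN' := ltnW iN.
  rewrite (base i 0%N iN' N_gt0) ?orbT // (base i.+1 0%N iN N_gt0) ?orbT //.
  rewrite (base i N.-1 iN' NP') ?NP ?eqxx ?orbT // (base i.+1 N.-1 iN NP') ?NP ?eqxx ?orbT //.
  by rewrite lam0; case: (row i _); case: (row i.+1 _).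
have rowN : row 0%N N.-1 = false.
  rewrite (row0 N.-1 NP') /row big1 // => l _.
  have lN : (l.+1 < N)%N by have := ltn_ord l; rewrite -ltnS NP.
  by rewrite (base N.-1 l NP' (ltnW lN)) ?(base N.-1 l.+1 NP' lN) ?NP ?eqxx.
have left_w k e : (e < m)%N -> (e * M <= k < e.+1 * M)%N ->
    forall l, (k <= l <= k.+1)%N -> 0 < gam (g l) (sq 0%N k) /\
      e%:R <= m%:R * g l <= e.+1%:R.
  move=> em /andP[ek ke] l kl.
  have eN : (e.+1 * M <= N)%N by rewrite NE leq_mul2r em orbT.
  split.
    have kN : (k < N)%N := leq_trans ke eN.
    have lN : (l <= N)%N by case/andP: kl => _ /leq_trans; apply.
    by rewrite -(HL l lN) sqG.
  have -> : m%:R * g l = l%:R / M%:R.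
    rewrite gE NE natrM; field; apply/andP; split; rewrite gt_eqF ?ltr0n //.
  by rewrite ler_pdivlMr ?ler_pdivrMr ?ltr0n // -!natrM !ler_nat; move: ek ke kl; clear; lia.
pose pre e := \big[addb/false]_(i < e) lam (w i) (w i.+1).
have edge_tri e a b c : (e < m)%N -> a = w e \/ a = w e.+1 -> b = w e \/ b = w e.+1 ->
    c = w e \/ c = w e.+1 -> lam a b (+) lam b c = lam a c.
  move=> em ae be ce.
  have inW u : u = w e \/ u = w e.+1 -> u \in W by case=> ->; apply: wW; rewrite // ltnW.
  apply: lamW; try exact: inW; have /asboolP := wE e em.
  move=> /simplex_face; apply; last by apply/fset0Pn; exists a; rewrite !inE eqxx.
  apply/fsubsetP => u; rewrite !inE -orbA => /or3P[] /eqP ->.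
  - by case: ae => ->; rewrite eqxx ?orbT.
  - by case: be => ->; rewrite eqxx ?orbT.
  - by case: ce => ->; rewrite eqxx ?orbT.
(* Up to column [k], row 0 has the same sum as the loop up to the start of its edge [k %/ M],
   followed by a step to the vertex chosen for the square. *)
have col k : (k < N)%N -> row 0%N k = pre (k %/ M)%N (+) lam (w (k %/ M)%N) (sq 0%N k).
  elim: k => [|k IHk] kN.
    by rewrite /row /pre div0n !big_ord0 base ?eqxx ?orbT // lam0.
  rewrite /row big_ord_recr /= -/(row 0%N k) IHk ?(ltnW kN) //.
  set e := (k %/ M)%N.
  have em : (e < m)%N by rewrite ltn_divLR // -NE; exact: ltnW.
  have ekM : (e * M <= k < e.+1 * M)%N by rewrite leq_trunc_div // ltn_ceil.
  have sk : sq 0%N k = w e \/ sq 0%N k = w e.+1.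
    have [pos em'] := left_w k e em ekM k (kk0 k).
    by apply: (polygon_path_block _ em em' pos); apply/g01/ltnW/ltnW.
  have [lt|ge] := ltnP k.+1 (e.+1 * M).
    have -> : (k.+1 %/ M)%N = e.
      by apply/eqP; rewrite eqn_leq leq_divRL // -ltnS ltn_divLR // lt; case/andP: ekM => /leqW.
    have ekM' : (e * M <= k.+1 < e.+1 * M)%N by case/andP: ekM => /leqW ->.
    have [pos em'] := left_w k.+1 e em ekM' k.+1 (kk0 _).
    have sk1 := polygon_path_block (g01 _ (ltnW kN)) em em' pos.
    by rewrite -addbA (edge_tri e) //; left.
  (* At the end of a block the common corner of the two squares is mapped to [w e.+1], so both
     squares have this vertex. *)
  have kE : k.+1 = (e.+1 * M)%N.
    by apply/eqP; rewrite eqn_leq ge andbT; case/andP: ekM.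
  have e1m : (e.+1 < m)%N by rewrite -(ltn_pmul2r M_gt0) -kE -NE.
  have gk : m%:R * g k.+1 = e.+1%:R.
    by rewrite gE NE kE !natrM; field; apply/andP; split; rewrite gt_eqF ?ltr0n.
  have -> : (k.+1 %/ M)%N = e.+1 by rewrite kE mulnK.
  have [pos _] := left_w k e em ekM k.+1 (kk1 k).
  have -> : sq 0%N k = w e.+1.
    exact: (polygon_path_vertex (g01 _ (ltnW kN)) (ltnW e1m) gk pos).
  have ekM' : (e.+1 * M <= k.+1 < e.+2 * M)%N.
    by rewrite kE leqnn /= ltn_pmul2r // ltnSn.
  have [pos' _] := left_w k.+1 e.+1 e1m ekM' k.+1 (kk0 _).
  have -> : sq 0%N k.+1 = w e.+1.
    exact: (polygon_path_vertex (g01 _ (ltnW kN)) (ltnW e1m) gk pos').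
  by rewrite /pre big_ord_recr.
rewrite edge_sum_nth -/m -/(pre m).
have := col N.-1; rewrite prednK // leqnn rowN base ?prednK ?eqxx ?orbT // => /(_ isT) ->.
have -> : (N.-1 %/ M)%N = m.-1.
  by apply/eqP; rewrite eqn_leq -ltnS prednK // ltn_divLR // -NE NP' leq_divRL // -ltnS NP NE
    ltn_pmul2r // ltn_predL.
have mS : m.-1.+1 = m by rewrite prednK.
have -> : pre m = pre m.-1 (+) lam (w m.-1) (w m).
  by rewrite -{1}mS /pre big_ord_recr /= mS.
by rewrite wm.
Qed.

End EdgePaths.

(** * Orbits of simplices *)

Section Orbits.
Variables (R : realType) (G : groupType) (V : choiceType).
Variables (Z : simplicial_complex V) (act : simplicial_action G Z).
Local Open Scope ring_scope.
Local Notation X := (realization R Z).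
Implicit Types (s t : {fset V}) (g h : G) (u v : V) (x y : X).

Definition translate g s : {fset V} := [fset act g v | v in s]%fset.

Lemma actK g : cancel (act g) (act g^-1%g).
Proof. by move=> v; rewrite -sactM mulVg sact1. Qed.

Lemma actVK g : cancel (act g^-1%g) (act g).
Proof. by move=> v; rewrite -sactM mulgV sact1. Qed.

Lemma act_inj g : injective (act g).
Proof. exact: can_inj (actK g). Qed.

Lemma mem_translate g s v : (v \in translate g s) = (act g^-1%g v \in s).
Proof.
apply/imfsetP/idP => [[u us ->]|vs]; first by rewrite actK.
by exists (act g^-1%g v); rewrite ?actVK.
Qed.

Lemma translateM g h s : translate g (translate h s) = translate (g * h)%g s.
Proof. by apply/fsetP => v; rewrite !mem_translate invgM sactM. Qed.

Lemma translate1 s : translate 1%g s = s.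
Proof. by apply/fsetP => v; rewrite mem_translate invg1 sact1. Qed.

Lemma card_translate g s : #|` translate g s| = #|` s|.
Proof. by rewrite card_imfset //; exact: act_inj. Qed.

Lemma simplex_translate g s : simplex Z s -> simplex Z (translate g s).
Proof. exact: sact_simplex. Qed.

Lemma barycenter_subproof s : simplex Z s ->
  exists2 t, simplex Z t & closed_simplex t (fun v => (v \in s)%:R / #|` s|%:R : R).
Proof.
move=> Zs; exists s => //; split=> [v|v /negbTE ->|]; rewrite ?mul0r ?divr_ge0 //.
have s0 : (#|` s|%:R : R) != 0 by rewrite pnatr_eq0 cardfs_eq0 (simplex_neq0 Zs).
rewrite -mulr_suml big_seq (eq_bigr (fun=> 1)) => [|v ->//].
by rewrite -big_seq big_tnth sumr_const card_ord -/(#|` s|) divff.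
Qed.

Definition barycenter s (Zs : simplex Z s) : X := Realization (barycenter_subproof Zs).

Lemma barycenter_gt0 s (Zs : simplex Z s) v : (0 < barycenter Zs v) = (v \in s).
Proof.
rewrite /=; case vs : (v \in s); last by rewrite mul0r ltxx.
by rewrite mul1r invr_gt0 ltr0n cardfs_gt0 (simplex_neq0 Zs).
Qed.

Lemma barycenter_inj s t (Zs : simplex Z s) (Zt : simplex Z t) :
  barycenter Zs = barycenter Zt -> s = t.
Proof. by move=> e; apply/fsetP => v; rewrite -!barycenter_gt0 e. Qed.

Lemma ract_barycenter g s (Zs : simplex Z s) :
  ract act g (barycenter Zs) = barycenter (simplex_translate g Zs).
Proof.
by apply: realizationP => v; rewrite /= mem_translate card_translate.
Qed.

Lemma avoid_finitely_many (l : seq X) s x :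
  closed_simplex s x -> (forall b, List.In b l -> closed_simplex s b /\ b <> x) ->
  exists2 e : R, 0 < e & forall y, (forall v, v \in s -> `|y v - x v| < e) -> ~ List.In y l.
Proof.
move=> sx; elim: l => [|b l IHl] bl; first by exists 1 => // y _ [].
have [|e e0 eP] := IHl; first by move=> c cl; apply: bl; right.
have [sb bx] := bl b (or_introl erefl).
have [v vs bv] : exists2 v, v \in s & b v != x v.
  apply: contrapT => H; apply/bx/realizationP => v.
  have [vs|vs] := boolP (v \in s); last first.
    by move/closed_simplexE: sb => ->//; move/closed_simplexE: sx => ->.
  by apply: contrapT => /eqP bv; apply: H; exists v.
exists (Num.min e `|b v - x v|).
  by rewrite lt_min e0 normr_gt0 subr_eq0.
move=> y yx [e'|]; last first.
  by apply: eP => w /yx; rewrite lt_min => /andP[].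
by have := yx v vs; rewrite -e' lt_min ltxx andbF.
Qed.

(** Any set of barycenters is closed, because a closed simplex contains only those of its finitely
    many faces. *)
Lemma open_avoid_barycenters (A : set {fset V}) :
  open [set x : X | forall s (Zs : simplex Z s), A s -> x <> barycenter Zs].
Proof.
rewrite realization_openE => s Zs x /= xA sx.
pose sub := [seq t <- fpowerset s | `[< A t /\ simplex Z t >]].
have [l lP] : exists l : seq X, forall b, List.In b l <->
    exists t (Zt : simplex Z t), [/\ t \in sub, A t & b = barycenter Zt].
  elim: sub => [|t sub [l lP]].
    by exists [::] => b; split=> // -[t [Zt []]].
  have [[At Zt]|nt] := pselect (A t /\ simplex Z t).
    exists (barycenter Zt :: l) => b; split=> [[<-|/lP[t' [Zt' [t's At' ->]]]]|].
    - by exists t, Zt; rewrite mem_head.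
    - by exists t', Zt'; rewrite in_cons t's orbT.
    case=> t' [Zt' [+ At' ->]]; rewrite in_cons => /orP[/eqP e|t's]; last first.
      by right; apply/lP; exists t', Zt'.
    by left; subst t'; rewrite (Prop_irrelevance Zt Zt').
  exists l => b; split=> [/lP[t' [Zt' [t's At' ->]]]|].
    by exists t', Zt'; rewrite in_cons t's orbT.
  case=> t' [Zt' [+ At' ->]]; rewrite in_cons => /orP[/eqP e|t's]; last first.
    by apply/lP; exists t', Zt'.
  by case: nt; subst t'.
have [|e e0 eP] := @avoid_finitely_many l s x sx.
  move=> b /lP[t [Zt [ts At ->]]]; split; last by apply/nesym/xA.
  apply/closed_simplexE => v vs; rewrite /= (_ : v \in t = false) ?mul0r //.
  apply/negbTE; apply: contra vs; apply/fsubsetP; rewrite -fpowersetE.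
  by move: ts; rewrite mem_filter => /andP[].
exists e => // y sy yx t Zt At yt; apply: (eP y yx); apply/lP; exists t, Zt; split=> //.
rewrite mem_filter; apply/andP; split; first exact/asboolP.
rewrite fpowersetE; apply/fsubsetP => v; rewrite -(barycenter_gt0 Zt) -yt => yv.
by apply: contraT => vs; move/closed_simplexE/(_ v vs): sy yv => ->; rewrite ltxx.
Qed.

(** The barycenters form a closed discrete set. *)
Lemma compact_finite_barycenters (K : set X) : compact K ->
  finite_set [set s | exists Zs : simplex Z s, K (barycenter Zs)].
Proof.
move=> cK; apply: contrapT => Binf; set B := [set s | _] in Binf.
(* The cofinite filter on the barycenters in [K]; if there are infinitely many, it has a cluster
   point [x] in [K]. *)
pose F : set_system X := [set A : set X |
  finite_set [set s | B s /\ ~ forall Zs : simplex Z s, A (barycenter Zs)]].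
have FF : ProperFilter F.
  split; last split.
  - rewrite /F /= => F0; apply: Binf; apply: (sub_finite_set _ F0) => s [Zs KZs].
    by split; [exists Zs | move=> /(_ Zs)].
  - by rewrite /F /= (_ : mkset _ = set0) // -subset0 => s [_]; apply.
  - rewrite /F /= => A A' FA FA'; apply: (sub_finite_set _ (_ : finite_set (_ `|` _))).
      2: by rewrite finite_setU; split; [exact: FA | exact: FA'].
    move=> s [Bs nA]; have [sA|nsA] := pselect (forall Zs : simplex Z s, A (barycenter Zs)).
      by right; split=> // sA'; apply: nA => Zs; split.
    by left.
  - rewrite /F /= => A A' AA' FA; apply: (sub_finite_set _ FA) => s [Bs nA']; split=> // sA.
    by apply: nA' => Zs; apply/AA'/sA.
have [|x [Kx Fx]] := cK F FF.
  rewrite /F /= (_ : mkset _ = set0) // -subset0 => s [[Zs KZs]]; apply => Zs'.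
  by rewrite (Prop_irrelevance Zs' Zs).
pose O := [set y : X | forall s (Zs : simplex Z s),
  (forall Zs' : simplex Z s, barycenter Zs' <> x) -> y <> barycenter Zs].
have oO : nbhs x O.
  apply: open_nbhs_nbhs; split; first exact: open_avoid_barycenters.
  by move=> s Zs /(_ Zs)/nesym.
(* At most one simplex has barycenter [x], so the set of the other barycenters belongs to [F]; but
   the neighbourhood [O] of [x] contains none of them. *)
have [|y [[s [Zs [sx yE]]] yO]] := Fx [set y | exists s (Zs : simplex Z s),
    barycenter Zs <> x /\ y = barycenter Zs] O _ oO.
  have [[t [Zt xt]]|nt] := pselect (exists t (Zt : simplex Z t), x = barycenter Zt); last first.
    rewrite /F /= (_ : mkset _ = set0) // -subset0 => s [_]; apply => Zs.
    by exists s, Zs; split=> // e; apply: nt; exists s, Zs.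
  apply: (@sub_finite_set _ _ [set t]); last exact: finite_set1.
  move=> s [_ ns]; apply: contrapT => st; apply: ns => Zs; exists s, Zs; split=> //.
  by rewrite xt => /barycenter_inj.
apply: (yO s Zs) => // Zs'.
by rewrite (Prop_irrelevance Zs' Zs).
Qed.

Hypothesis freeA : acts_freely R act.
Hypothesis cocA : acts_cocompactly R act.

Lemma finitely_many_orbits : exists E : {fset {fset V}},
  forall s, simplex Z s -> exists g t, [/\ t \in E, simplex Z t & s = translate g t].
Proof.
have [K cK KP] := cocA.
have /finite_fsetP[E EE] := compact_finite_barycenters cK.
exists E => s Zs; have [g [y Ky sy]] := KP (barycenter Zs).
have yE : y = barycenter (simplex_translate g^-1%g Zs).
  rewrite -ract_barycenter sy; apply: realizationP => v /=.
  by rewrite invgK actK.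
exists g, (translate g^-1%g s); split.
- suff : [set` E] (translate g^-1%g s) by [].
  by rewrite -EE /=; exists (simplex_translate g^-1%g Zs); rewrite -yE.
- exact: simplex_translate.
- by rewrite translateM mulgV translate1.
Qed.

Lemma vertex_free g v : act g v = v -> g = 1%g.
Proof.
move=> gv; apply: (freeA (x := vertex_point R Z v)); apply: realizationP => w /=.
by rewrite -(inj_eq (@act_inj g)) actVK gv.
Qed.

Lemma transporter_finite u v : finite_set [set g | act g u = v].
Proof.
have [[g gu]|H] := pselect (exists g, act g u = v); last first.
  by rewrite (_ : mkset _ = set0) // -subset0 => g gu; apply: H; exists g.
apply: (@sub_finite_set _ _ [set g]); last exact: finite_set1.
move=> h /= hu; apply/eqP; rewrite -(divg_eq1 h g); apply/eqP/(@vertex_free _ v).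
by rewrite sactM -{1}gu actK.
Qed.

Lemma fundamental_vertices : exists F : {fset V},
  (forall s, simplex Z s -> exists g t, [/\ {subset t <= F} & s = translate g t]).
Proof.
have [E EP] := finitely_many_orbits.
exists (\bigcup_(t <- E) t)%fset => s /EP[g [t [tE Zt ->]]]; exists g, t; split=> //.
by move=> v vt; apply/bigfcupP; exists t; rewrite ?tE.
Qed.

Variable F : {fset V}.
Hypothesis FP : forall s, simplex Z s -> exists g t, {subset t <= F} /\ s = translate g t.

Lemma vertex_orbit v : exists q : G * V, v = act q.1 q.2 /\ q.2 \in F.
Proof.
have [g [t [tF e]]] := FP (simplex_vertex Z v).
have : v \in translate g t by rewrite -e inE.
rewrite mem_translate => vt; exists (g, act g^-1%g v); rewrite /= actVK; split=> //.
exact: tF.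
Qed.

(** Local finiteness, read in the group: an edge is a translate [h t] with vertices of [t] in [F],
    and by freeness finitely many [h] carry a vertex of [F] to [u]. *)
Lemma adjacent_finite u v : finite_set [set g | simplex Z [fset u; act g v]%fset].
Proof.
apply: (@sub_finite_set _ _ (\bigcup_(u' in [set` F]) \bigcup_(h in [set h | act h u' = u])
   \bigcup_(v' in [set` F]) [set g | act g v = act h v'])).
  move=> g /= /FP[h [t [tF e]]].
  have : u \in translate h t by rewrite -e !inE eqxx.
  have : act g v \in translate h t by rewrite -e !inE eqxx orbT.
  rewrite !mem_translate => /tF vF /tF uF.
  exists (act h^-1%g u) => //; exists h; rewrite /= ?actVK //.
  by exists (act h^-1%g (act g v)); rewrite //= actVK.
apply: bigcup_finite => [|u' _]; first exact: finite_fset.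
apply: bigcup_finite => [|h _]; first exact: transporter_finite.
by apply: bigcup_finite => [|v' _]; [exact: finite_fset | exact: transporter_finite].
Qed.

End Orbits.

(** * Short primitives *)

Section EdgeSums.
Variable V : choiceType.
Implicit Types (lam : V -> V -> bool) (v : V) (p q : seq V).

Lemma edge_sum_cat lam v p q :
  edge_sum lam v (p ++ q) = edge_sum lam v p (+) edge_sum lam (last v p) q.
Proof. by elim: p v => [|u p IHp] v //=; rewrite IHp addbA. Qed.

Lemma edge_sum_map lam (f : V -> V) v p :
  edge_sum lam (f v) (map f p) = edge_sum (fun a b => lam (f a) (f b)) v p.
Proof. by elim: p v => [|u p IHp] v //=; rewrite IHp. Qed.

Lemma edge_sum_eq0 lam v p :
  (forall a b, a \in v :: p -> lam a b = false) -> edge_sum lam v p = false.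
Proof.
elim: p v => [|u p IHp] v //= H; rewrite H ?mem_head // IHp // => a b ap.
by apply: H; rewrite inE ap orbT.
Qed.

End EdgeSums.

Section LocalCocycle.
Variables (R : realType) (G : groupType) (V : choiceType).
Variables (Z : simplicial_complex V) (act : simplicial_action G Z).
Hypothesis freeA : acts_freely R act.
Hypothesis scZ : simply_connected R (realization R Z).
Variable S : {fset G}.
Hypothesis genS : generates S.
Local Notation len := (word_length S).
Local Notation d := (wdist S).
Variable F : {fset V}.
Hypothesis FP : forall s, simplex Z s -> exists g t, {subset t <= F} /\ s = translate act g t.
Variable orb : V -> G * V.
Hypothesis orbP : forall v, v = act (orb v).1 (orb v).2 /\ (orb v).2 \in F.
Implicit Types (g h k x y : G) (u v w : V) (lam : V -> V -> bool).

Definition twist g lam u v := lam (act g u) (act g v).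

Lemma translate_fset2 g u v :
  translate act g [fset u; v]%fset = [fset act g u; act g v]%fset.
Proof.
apply/fsetP => x; rewrite mem_translate !inE.
have actE (t : V) := inj_eq (@act_inj _ _ _ act g) (act g^-1%g x) t.
by rewrite -(actE u) -(actE v) actVK.
Qed.

Lemma path_translate g v p : path (edge Z) v p -> path (edge Z) (act g v) (map (act g) p).
Proof.
elim: p v => //= u p IHp v /andP[/asboolP vu /IHp ->]; rewrite andbT; apply/asboolP.
by rewrite -translate_fset2; exact: simplex_translate.
Qed.

Lemma translate_fset3 g u v w :
  translate act g [fset u; v; w]%fset = [fset act g u; act g v; act g w]%fset.
Proof.
apply/fsetP => x; rewrite mem_translate !inE.
have actE (t : V) := inj_eq (@act_inj _ _ _ act g) (act g^-1%g x) t.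
by rewrite -(actE u) -(actE v) -(actE w) actVK.
Qed.

Lemma edge_sum_translate lam g v p :
  edge_sum lam (act g v) (map (act g) p) = edge_sum (twist g lam) v p.
Proof. exact: edge_sum_map. Qed.

Lemma loops_filling (L : seq (V * seq V)) :
  (forall q, q \in L -> path (edge Z) q.1 q.2 /\ last q.1 q.2 = q.1) ->
  exists W, forall lam, cocycle_on Z W lam ->
    forall q, q \in L -> edge_sum lam q.1 q.2 = false.
Proof.
elim: L => [|q L IHL] LP; first by exists fset0.
have [|W WP] := IHL; first by move=> q' q'L; apply: LP; rewrite inE q'L orbT.
have [pq lq] := LP q (mem_head _ _); have [W' W'P] := loop_filling scZ pq lq.
exists (W `|` W')%fset => lam lamW q'; rewrite inE => /orP[/eqP ->|q'L].
  by apply: W'P => u v w uW vW wW; apply: lamW; rewrite inE ?uW ?vW ?wW orbT.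
by apply: WP q'L => u v w uW vW wW; apply: lamW; rewrite inE ?uW ?vW ?wW.
Qed.

Lemma finite_len_bound (A : set G) : finite_set A -> exists n, forall g, A g -> len g <= n.
Proof.
move=> /finite_fsetP[B ->]; exists (\max_(g <- B) len g) => g /= gB.
by rewrite (leq_bigmax_seq (F := fun x => len x)).
Qed.

Lemma edge_translate g u v : edge Z (act g u) (act g v) -> edge Z u v.
Proof.
move=> e; have := @path_translate g^-1%g (act g u) [:: act g v].
by rewrite /= !actK e => /(_ isT); rewrite andbT.
Qed.

Lemma edge_dist_bound : exists D, forall u v, edge Z u v -> d (orb u).1 (orb v).1 <= D.
Proof.
have fin : finite_set (\bigcup_(f in [set` F]) \bigcup_(f' in [set` F])
    [set x | simplex Z [fset f; act x f']%fset]).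
  apply: bigcup_finite => [|f _]; first exact: finite_fset.
  apply: bigcup_finite => [|f' _]; first exact: finite_fset.
  by have := adjacent_finite freeA FP f f'.
have [D DP] := finite_len_bound fin; exists D => u v uv.
have [eu uF] := orbP u; have [ev vF] := orbP v.
apply: DP; exists (orb u).2 => //; exists (orb v).2 => //=; apply/asboolP.
by apply: (@edge_translate (orb u).1); rewrite -sactM mulVKg -eu -ev.
Qed.

Variables (v0 : V) (tau : G -> seq V) (sig sig' : V -> seq V).
Hypothesis tauP : forall x, path (edge Z) v0 (tau x) /\ last v0 (tau x) = act x v0.
Hypothesis sigP : forall f, path (edge Z) v0 (sig f) /\ last v0 (sig f) = f.
Hypothesis sig'P : forall f, path (edge Z) f (sig' f) /\ last f (sig' f) = v0.

(** [tau x] is a path from [v0] to [x v0]; its translate runs from [g v0] to [h v0]. Likewise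
    [vertex_cochain] sums along a path from [(orb u).1 v0] to [u]. *)
Definition group_cochain lam g h := edge_sum (twist g lam) v0 (tau (g^-1 * h)%g).
Definition vertex_cochain lam u := edge_sum (twist (orb u).1 lam) v0 (sig (orb u).2).

(** Both identities sum [lam] over translates of finitely many loops: [tri] is a triangle of paths
    [tau], [quad] goes along an edge and back through base points, [lasso] goes out along [sig] and
    back along [sig']. One finite [W] fills all of them, and [f0] is chosen so that the translate
    [g W] meets no defect of [lam] when [g] is far from [Y]. *)
Lemma local_cocycle (r D : nat) : exists f0, forall lam (Y : {fset G}),
  (forall u v w, simplex Z [fset u; v; w]%fset -> lam u v (+) lam v w <> lam u w ->
     (orb u).1 \in Y) ->
  (forall g h k, d g h <= r -> d h k <= r -> far_from_Y S Y f0 g ->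
     group_cochain lam g h (+) group_cochain lam h k (+) group_cochain lam k g = false) /\
  (forall u v, edge Z u v -> d (orb u).1 (orb v).1 <= D ->
     far_from_Y S Y f0 (orb u).1 -> far_from_Y S Y f0 (orb v).1 ->
     lam u v = vertex_cochain lam u (+) vertex_cochain lam v (+)
               group_cochain lam (orb v).1 (orb u).1).
Proof.
have [B BP] := finite_ball genS (maxn r D).
pose tri (q : G * G) := (v0, tau q.1 ++ map (act q.1) (tau q.2) ++
   map (act (q.1 * q.2)%g) (tau (q.1 * q.2)^-1%g)).
pose lasso f := (v0, sig f ++ sig' f).
pose quad (q : V * (G * V)) := let: (f, (x, f')) := q in
   (v0, sig f ++ [:: act x f'] ++ map (act x) (sig' f') ++ map (act x) (tau x^-1%g)).
pose L := [seq tri (x, y) | x <- B, y <- B] ++ [seq lasso f | f <- F] ++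
  [seq quad q | q <- [seq (f, q) | f <- F, q <- [seq (x, f') | x <- B, f' <- F]]
              & edge Z q.1 (act q.2.1 q.2.2)].
have [|W WP] := @loops_filling L.
  move=> q; rewrite !mem_cat => /or3P[].
  - case/allpairsP => -[x y] [_ _ ->]; rewrite /tri /=.
    have [px lx] := tauP x; have [py ly] := tauP y; have [pz lz] := tauP (x * y)^-1%g.
    rewrite cat_path last_cat px lx cat_path last_cat path_translate // last_map ly /=.
    by rewrite -sactM path_translate // last_map lz -sactM mulgV sact1.
  - case/mapP => f _ ->; rewrite /lasso /=.
    have [pf lf] := sigP f; have [pf' lf'] := sig'P f.
    by rewrite cat_path last_cat pf lf pf' lf'.
  - case/mapP => -[f [x f']]; rewrite mem_filter => /andP[/= e _] ->; rewrite /quad /=.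
    have [pf lf] := sigP f; have [pf' lf'] := sig'P f'; have [pz lz] := tauP x^-1%g.
    rewrite cat_path last_cat /= pf lf e /= cat_path last_cat path_translate //=.
    by rewrite last_map lf' path_translate // last_map lz -sactM mulgV sact1.
have [f0 f0P] : exists f0, forall x,
    (exists u f, [/\ u \in W, f \in F & act x f = u]) -> len x <= f0.
  apply: finite_len_bound; apply: (@sub_finite_set _ _
    (\bigcup_(u in [set` W]) \bigcup_(f in [set` F]) [set x | act x f = u])).
    by move=> x [u [f [uW fF xf]]]; exists u => //; exists f.
  apply: bigcup_finite => [|u _]; first exact: finite_fset.
  by apply: bigcup_finite => [|f _]; [exact: finite_fset | exact: transporter_finite freeA _ _].
exists f0 => lam Y lamY.
have coc g : far_from_Y S Y f0 g -> cocycle_on Z W (twist g lam).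
  move=> gY u v w uW vW wW Zuvw; apply: contrapT => ne.
  have := gY (orb (act g u)).1; rewrite ltnNge.
  rewrite (lamY _ (act g v) (act g w)) //; last first.
    by rewrite -translate_fset3; exact: simplex_translate.
  move=> /(_ isT) /negP; apply; apply: f0P; exists u, (orb (act g u)).2.
  have [e fF] := orbP (act g u); split=> //.
  by rewrite sactM -e actK.
split=> [g h k gh hk gY|u v uv duv uY vY].
  pose x := (g^-1 * h)%g; pose y := (h^-1 * k)%g.
  have xB : x \in B by apply: BP; rewrite leq_max gh.
  have yB : y \in B by apply: BP; rewrite leq_max hk.
  have := WP _ (coc g gY) (tri (x, y)); rewrite mem_cat allpairs_f // => /(_ isT).
  rewrite /tri /= !edge_sum_cat; have [_ ->] := tauP x.
  rewrite last_map; have [_ ->] := tauP y; rewrite -sactM.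
  rewrite !edge_sum_translate /group_cochain -/x -/y addbA => <-.
  have gx : (g * x)%g = h by rewrite /x mulVKg.
  have gxy : (g * (x * y))%g = k by rewrite mulgA gx /y mulVKg.
  have tw z : twist z (twist g lam) = twist (g * z)%g lam.
    by apply/funext => a; apply/funext => b; rewrite /twist !sactM.
  rewrite !tw gx gxy; congr (_ (+) edge_sum _ _ (tau _)).
  by rewrite -gxy invgM mulgA mulgVK.
have [eu uF] := orbP u; have [ev vF] := orbP v.
set g := (orb u).1 in eu duv uY *; set h := (orb v).1 in ev duv vY *.
set f := (orb u).2 in eu uF *; set f' := (orb v).2 in ev vF *.
pose x := (g^-1 * h)%g; have gx : (g * x)%g = h by rewrite /x mulVKg.
have xB : x \in B by apply: BP; rewrite leq_max duv orbT.
have tw z : twist z (twist g lam) = twist (g * z)%g lam.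
  by apply/funext => a; apply/funext => b; rewrite /twist !sactM.
have e : edge Z f (act x f').
  by apply: (@edge_translate g); rewrite -sactM gx -eu -ev.
have := WP _ (coc g uY) (quad (f, (x, f'))); rewrite !mem_cat.
have -> : quad (f, (x, f')) \in [seq quad q |
    q <- [seq (f, q) | f <- F, q <- [seq (x, f') | x <- B, f' <- F]] & edge Z q.1 (act q.2.1 q.2.2)].
  by apply/map_f; rewrite mem_filter /= e allpairs_f // allpairs_f.
rewrite !orbT => /(_ isT); rewrite /quad edge_sum_cat /= edge_sum_cat.
have [_ ->] := sigP f; rewrite last_map; have [_ ->] := sig'P f'.
rewrite !edge_sum_translate !tw gx {2}/twist -sactM gx -eu -ev.
(* Replaces the return path [sig'] by [sig], as in [vertex_cochain]. *)
have := WP _ (coc h vY) (lasso f'); rewrite !mem_cat map_f // orbT => /(_ isT).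
rewrite /lasso /= edge_sum_cat; have [_ ->] := sigP f'.
rewrite /vertex_cochain /group_cochain -/g -/h -/f -/f'.
have -> : (h^-1 * g)%g = x^-1%g by rewrite /x invgM invgK.
by do 4!case: (edge_sum _ _ _); case: (lam u v).
Qed.

End LocalCocycle.

Section Parity.
Variable V : choiceType.
Implicit Types (u v w : V) (s t : {fset V}) (l : {fset {fset V}}).

Lemma card_fset_filter (T : choiceType) (A : {fset T}) (e : seq T) (P : pred T) :
  uniq e -> (forall x, (x \in A) = (x \in e) && P x) -> #|` A| = count P e.
Proof.
move=> ue AP; rewrite -size_filter; apply/perm_size/uniq_perm; rewrite ?filter_uniq //.
by move=> x; rewrite mem_filter AP andbC.
Qed.

(** Translates between the coboundary of a set of edges and the cocycle condition for its
    characteristic function. *)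
Lemma parity_triangle l u v w : (forall s, s \in l -> #|` s| = 2) ->
  u != v -> v != w -> u != w ->
  odd #|` [fset s in l | (s `<=` [fset u; v; w])%fset]%fset| =
    ([fset u; v]%fset \in l) (+) ([fset v; w]%fset \in l) (+) ([fset u; w]%fset \in l).
Proof.
move=> l2 uv vw uw.
have ne (a b c : V) : a != c -> b != c -> forall s, c \in s -> [fset a; b]%fset != s.
  move=> ac bc s cs; apply: contraTneq cs => <-.
  by rewrite !inE !(eq_sym c) (negbTE ac) (negbTE bc).
have ue : uniq [:: [fset u; v]; [fset v; w]; [fset u; w]]%fset.
  rewrite /= !inE negb_or !andbT !(ne u v w) ?inE ?eqxx ?orbT //=.
  by rewrite (ne v w u) ?inE ?eqxx 1?eq_sym.
rewrite (card_fset_filter (P := mem l) ue) /=.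
  by rewrite addn0 !oddD !oddb addbA.
move=> s; rewrite !inE /= andbC; case sl : (s \in l); rewrite ?andbF ?andbT //.
apply/idP/idP => [/fsubsetP sub|].
  have uvw : uniq [:: u; v; w] by rewrite /= !inE negb_or uv uw vw.
  have := card_fset_filter (A := s) (P := mem s) uvw.
  rewrite (l2 s sl) /= addn0 => sE.
  have {}sE : 2 = (u \in s) + (v \in s) + (w \in s).
    by rewrite -addnA sE // => x; case xs : (x \in s); rewrite ?andbF // andbT;
      have := sub x xs; rewrite !inE -orbA => ->.
  have eq a b c : (forall x, x \in s -> [|| x == a, x == b | x == c]) ->
      a \in s -> b \in s -> c \notin s -> s = [fset a; b]%fset.
    move=> abc as_ bs cs; apply/fsetP => x; rewrite !inE; apply/idP/idP => [xs|/orP[]/eqP-> //].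
    by case/or3P: (abc x xs) => /eqP e; rewrite e ?eqxx ?orbT //; rewrite e (negbTE cs) in xs.
  have sub' x : x \in s -> [|| x == u, x == v | x == w].
    by move/sub; rewrite !inE -orbA.
  move: sE; case us : (u \in s); case vs : (v \in s); case ws : (w \in s) => // _.
  - by rewrite (eq u v w) ?ws // eqxx.
  - rewrite (eq u w v) ?vs // ?eqxx ?orbT // => x /sub'.
    by case/or3P => ->; rewrite ?orbT.
  - rewrite (eq v w u) ?us // ?eqxx ?orbT // => x /sub'.
    by case/or3P => ->; rewrite ?orbT.
by case/or3P => /eqP ->; apply/fsubsetP => x; rewrite !inE => /orP[] ->; rewrite ?orbT.
Qed.

Lemma fset_cardS s n : #|` s| = n.+1 -> exists u t, [/\ u \notin t, #|` t| = n & s = (u |` t)%fset].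
Proof.
move=> sn; have /fset0Pn[u us] : s != fset0 by rewrite -cardfs_eq0 sn.
exists u, (s `\ u)%fset; split; first by rewrite !inE eqxx.
  by have := cardfsD1 u s; rewrite us sn add1n => -[].
by rewrite fsetD1K.
Qed.

Lemma fset_card2 s : #|` s| = 2 -> exists u v, u != v /\ s = [fset u; v]%fset.
Proof.
case/fset_cardS => u [t [ut /fset_cardS[v [t' [_ /cardfs0_eq -> te]]] ->]].
rewrite te fsetU0 inE in ut *; by exists u, v.
Qed.

Lemma fset_card3 s : #|` s| = 3 ->
  exists u v w, [/\ u != v, v != w, u != w & s = [fset u; v; w]%fset].
Proof.
case/fset_cardS => u [t [ut /fset_card2[v [w [vw te]]] ->]].
move: ut; rewrite te !inE negb_or => /andP[uv uw].
by exists u, v, w; rewrite fsetUA.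
Qed.

End Parity.

(** The new primitive differs from [l] by the coboundary of [At], which combines the potential [A]
    on positions with the vertex cochain inside each position. It is supported on edges with an
    endpoint in a position of [Bd]: there are at most [C * #|Y|] such positions, each with at most
    [size E1] edges, and [#|Y| <= 4 * #|a|]. *)
Lemma bounded_primitives (R : realType) (G : groupType) (V : choiceType)
    (Z : simplicial_complex V) (act : simplicial_action G Z) :
  geometrically_rigid_hyperbolic R G ->
  acts_freely R act ->
  acts_cocompactly R act ->
  simply_connected R (realization R Z) ->
  exists C : nat, forall l a, primitives Z 1 a l -> a != fset0 ->
    exists2 l', primitives Z 1 a l' & (#|` l'| <= C * #|` a|)%N.
Proof.
case=> S [genS hypR oneS no_cut] freeA cocA scZ.
have [delta hypS] := gprod_hyperbolic genS hypR.
have [M dirS] := three_directions_exist R genS hypS oneS.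
have [F FP] := fundamental_vertices cocA.
have [orb orbP] := choice (vertex_orbit FP).
have [D DP] := edge_dist_bound freeA S FP orbP.
have [v0] : exists v : V, True.
  have [[[x _] _] _] := scZ; have [v _] := coord_pos_exists x; by exists v.
move=> _; have conZ := edge_connected scZ.
have [tau tauP] := choice (fun x => conZ v0 (act x v0)).
have [sig sigP] := choice (fun f => conZ v0 f).
have [sig' sig'P] := choice (fun f => conZ f v0).
pose n' := (2 * delta + 1)%N; pose rho := (M + 2 * delta + 2 * D)%N.
have [rho' [R0 [rho_rho' chainS]]] := chain_connected_exists genS hypS oneS no_cut (2 * n') rho.
(* Large enough for a walk of at most [rho' + n'] steps and for neighbouring positions, both
   enlarged by the fellow-travelling constant. *)
pose r0 := (rho' + n' + 2 * delta + D + 1)%N.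
have [f0 f0P] := local_cocycle freeA scZ genS orbP tauP sigP sig'P r0 D.
pose R1 := (2 * R0 + 2 * rho' + 4 * delta + 2 * f0 + 2)%N.
pose R2 := (R1 + 2 * D)%N.
have [C CP] := count_branch_points genS hypS R2.
have [B BP] := finite_ball genS D.
pose E1 := [seq [fset f; act q.1 q.2]%fset | f <- F, q <- [seq (x, f') | x <- B, f' <- F]].
exists (C * size E1 * 4)%N => l a [l1 dl] a0.
pose lam u v := [fset u; v]%fset \in l.
have lam_sym u v : lam u v = lam v u by rewrite /lam fsetUC.
have card_l s : s \in l -> #|` s| = 2 by case/l1.
have lamxx u : lam u u = false.
  by apply/negbTE/negP => /card_l; rewrite fsetUid cardfs1.
pose verts := (\bigcup_(s <- a) s)%fset.
pose Y := (1%g |` [fset (orb v).1 | v in verts])%fset.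
have Y1 : 1%g \in Y by rewrite !inE eqxx.
have aE t : t \in a <-> simplex_dim Z 2 t /\ odd #|` [fset s in l | (s `<=` t)%fset]%fset|.
  by have := dl; move/seteqP => [/(_ t) h1 /(_ t) h2]; split=> [/h2|/h1].
have lamY u v w : simplex Z [fset u; v; w]%fset -> lam u v (+) lam v w <> lam u w ->
    (orb u).1 \in Y.
  move=> Zs ne.
  have [e|uv] := eqVneq u v; first by case: ne; rewrite e lamxx.
  have [e|vw] := eqVneq v w; first by case: ne; rewrite e lamxx addbF.
  have [e|uw] := eqVneq u w; first by case: ne; rewrite e lamxx (lam_sym v w) addbb.
  rewrite inE; apply/orP; right; apply/imfsetP; exists u => //=.
  apply/bigfcupP; exists [fset u; v; w]%fset; last by rewrite !inE eqxx.
  rewrite andbT; apply/aE; split; first split=> //.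
    by rewrite fsetUC !cardfsU1 cardfs1 !inE negb_or (eq_sym w u) (eq_sym w v) vw uw uv.
  rewrite (parity_triangle card_l uv vw uw) -/(lam u v) -/(lam v w) -/(lam u w).
  by move: ne; case: (lam u v); case: (lam v w); case: (lam u w).
have [cocl vertl] := f0P lam Y lamY.
set c := group_cochain act v0 tau lam in cocl vertl.
set e := vertex_cochain act orb v0 sig lam in vertl.
(* Unlike the constants above, [T] depends on [l]; it does not enter the final bound. *)
have [T cT] : exists T, forall g h, wdist S g h <= 1 -> T <= word_length S g -> c g h = false.
  have [B1 B1P] := finite_ball genS 1.
  pose W := (\bigcup_(x <- B1) [fset v in v0 :: tau x])%fset.
  pose lv := (\bigcup_(s <- l) s)%fset.
  have fin : finite_set (\bigcup_(w in [set` W]) \bigcup_(v in [set` lv])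
      [set g | act g w = v]).
    apply: bigcup_finite => [|w _]; first exact: finite_fset.
    apply: bigcup_finite => [|v _]; first exact: finite_fset.
    by have := transporter_finite freeA w v.
  have [T TP] := finite_len_bound S fin; exists T.+1 => g h gh Tg.
  apply: edge_sum_eq0 => u v up; apply/negP => uvl.
  move: Tg; rewrite ltnNge => /negP; apply; apply: TP; exists u.
    apply/bigfcupP; exists (g^-1 * h)%g; last by move: up; rewrite !inE.
    by rewrite andbT; apply: B1P.
  exists (act g u) => //; apply/bigfcupP; exists [fset act g u; act g v]%fset.
    by rewrite andbT; exact: uvl.
  by rewrite !inE eqxx.
have cocl' g h k : wdist S g h <= r0 -> wdist S h k <= r0 -> wdist S g k <= r0 ->
   far_from_Y S Y f0 g -> c g h (+) c h k (+) c k g = false.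
  by move=> gh hk _ gY; apply: cocl.
have [|||||A AP] := @potential_exists G S genS delta hypS Y f0 r0 T c Y1 cocl' cT rho rho' R0 R1
   _ rho_rho' chainS _ _ D M _ dirS _.
- by rewrite /rho; lia.
- by rewrite /r0 -/n'; lia.
- by rewrite /R1.
- by rewrite /r0; lia.
- by rewrite /rho; lia.
have [Bd cBd BdP] := CP Y Y1.
(* If some [y1] is not in the direction of 1, then 1 and [y1] cover [Y], since a point in neither
   direction would put [g] in [Bd]. *)
have good g : g \notin Bd -> exists a b, [/\ a \in Y, b \in Y & covered S Y R2 g a b].
  move=> gB; apply: contrapT => ng; case/negP: gB.
  have [y1 Y_1 y1g] : exists2 y, y \in Y & (gprod S g y 1%g < R2)%N.
    apply: contrapT => H; apply: ng; exists 1%g, 1%g; split=> // y yY; left.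
    by rewrite leqNgt; apply/negP => lt; apply: H; exists y.
  have [y2 [Y_2 y2g y12]] : exists y,
      [/\ y \in Y, (gprod S g y 1%g < R2)%N & (gprod S g y y1 < R2)%N].
    apply: contrapT => H; apply: ng; exists 1%g, y1; split=> // y yY.
    have [|lt1] := leqP R2 (gprod S g y 1%g); first by left.
    by right; rewrite leqNgt; apply/negP => lt2; apply: H; exists y.
  by apply: (BdP g y1 y2); rewrite // (gprodC genS).
pose At v := A (orb v).1 (+) e v.
have lamE u v : edge Z u v -> (orb v).1 \notin Bd -> lam u v = At u (+) At v.
  move=> uv /good[p [q [pY qY cov]]].
  have duv := DP u v uv; have dvu := duv; rewrite (wdistC genS) in dvu.
  have farv y : y \in Y -> (f0 + D < wdist S (orb v).1 y)%N.
    move=> yY; have := gprod_lel genS (orb v).1 y p; have := gprod_lel genS (orb v).1 y q.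
    by case: (cov y yY) => le; move: le; rewrite /R2 /R1 -!muln2; clear; lia.
  have fv : far_from_Y S Y f0 (orb v).1 by move=> y /farv; apply: leq_ltn_trans (leq_addr _ _).
  have fu : far_from_Y S Y f0 (orb u).1.
    move=> y /farv; have := wdist_tri genS (orb u).1 (orb v).1 y; move: dvu; clear; lia.
  rewrite (vertl u v uv duv fu fv) (AP _ _ p q dvu pY qY cov) /At.
  by case: (A _); case: (A _); case: (e u); case: (e v).
pose odd_cut (s : {fset V}) := odd #|` [fset v in s | At v]%fset|.
have odd_cutE u v : u != v -> odd_cut [fset u; v]%fset = At u (+) At v.
  move=> uv; rewrite /odd_cut (@card_fset_filter _ _ [:: u; v] At) /=.
  - by rewrite addn0 oddD !oddb.
  - by rewrite inE uv.
  - by move=> x; rewrite !inE.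
pose Eb := [fset s in [seq translate act g s | g <- Bd, s <- E1] |
    `[< simplex_dim Z 1 s >]]%fset.
(* [l] plus the coboundary of [At], cut down to [Eb]; by [lamE] nothing is lost. *)
pose l' := [fset s in Eb | (s \in l) (+) odd_cut s]%fset.
have l'mem s : (s \in l') = (s \in Eb) && ((s \in l) (+) odd_cut s).
  by rewrite in_fset.
have l'E u v : edge Z u v -> u != v -> ([fset u; v]%fset \in l') = lam u v (+) At u (+) At v.
  move=> uv unv; have [vB|vB] := boolP ((orb v).1 \in Bd); last first.
    rewrite l'mem odd_cutE // -/(lam u v) (lamE u v uv vB) !addbb andbF.
    by case: (At u); case: (At v).
  rewrite l'mem odd_cutE // -/(lam u v) -addbA.
  suff -> : [fset u; v]%fset \in Eb by [].
  rewrite inE /=; apply/andP; split; last first.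
    by apply/asboolP; split; [exact/asboolP | rewrite cardfs2 unv].
  rewrite /=; have [eu uF] := orbP u; have [ev vF] := orbP v.
  pose x := ((orb v).1^-1 * (orb u).1)%g.
  have -> : [fset u; v]%fset = translate act (orb v).1 [fset (orb v).2; act x (orb u).2]%fset.
    by rewrite translate_fset2 -ev -sactM mulVKg -eu fsetUC.
  apply: allpairs_f => //.
  rewrite /E1; apply/allpairsP; exists ((orb v).2, (x, (orb u).2)); split=> //=.
  apply: allpairs_f => //; apply: BP.
  by have := DP u v uv; rewrite (wdistC genS).
have card_l' s : s \in l' -> #|` s| = 2.
  by rewrite !inE => /andP[/andP[_ /asboolP[]]].
exists l'; first split.
- by move=> s; rewrite !inE => /andP[/andP[_ /asboolP]].
- rewrite -dl; suff par t : simplex_dim Z 2 t ->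
      odd #|` [fset s in l' | (s `<=` t)%fset]%fset| =
      odd #|` [fset s in l | (s `<=` t)%fset]%fset|.
    by apply/seteqP; split=> t [Zt o]; split=> //; move: o; rewrite par.
  case=> Zt /fset_card3[u [v [w [uv vw uw te]]]]; rewrite te in Zt *.
  rewrite (parity_triangle card_l' uv vw uw) (parity_triangle card_l uv vw uw).
  have edg p q : p \in [fset u; v; w]%fset -> q \in [fset u; v; w]%fset -> edge Z p q.
    move=> pt qt; apply/asboolP; apply: (simplex_face Zt).
      by apply/fsubsetP => x; rewrite !inE => /orP[] /eqP ->; move: pt qt; rewrite !inE.
    by apply/fset0Pn; exists p; rewrite !inE eqxx.
  have inu : u \in [fset u; v; w]%fset by rewrite !inE eqxx.
  have inv : v \in [fset u; v; w]%fset by rewrite !inE eqxx orbT.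
  have inw : w \in [fset u; v; w]%fset by rewrite !inE eqxx !orbT.
  rewrite !l'E ?edg // -/(lam u v) -/(lam v w) -/(lam u w).
  by case: (At u); case: (At v); case: (At w); case: (lam u v); case: (lam v w); case: (lam u w).
have cE : (#|` Eb| <= #|` Bd| * size E1)%N.
  rewrite -(size_allpairs (fun g s => translate act g s)).
  apply: leq_trans (_ : #|` [fset s in [seq translate act g s | g <- Bd, s <- E1]]%fset| <= _)%N.
    by apply: fsubset_leq_card; apply/fsubsetP => s; rewrite !inE => /andP[].
  by rewrite card_fseq size_undup.
have cl : (#|` l'| <= #|` Eb|)%N.
  by apply: fsubset_leq_card; apply/fsubsetP => s; rewrite !inE => /andP[].
have cv : (#|` verts| <= 3 * #|` a|)%N.
  rewrite /verts; apply: (@leq_trans (\sum_(s <- a) #|` s|)).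
    elim/big_rec2: _ => [|s n W _ le]; first by rewrite cardfs0.
    by rewrite cardfsU (leq_trans (leq_subr _ _)) // leq_add2l.
  rewrite big_seq (eq_bigr (fun=> 3)) => [|s /aE[[_ ->]] //].
  by rewrite -big_seq big_const_seq count_predT iter_addn_0.
have cY : (#|` Y| <= 4 * #|` a|)%N.
  have a1 : (0 < #|` a|)%N by rewrite cardfs_gt0.
  rewrite /Y cardfsU1.
  have : (#|` [fset (orb v).1 | v in verts]%fset| <= #|` verts|)%N by exact: leq_imfset_card.
  move=> cf.
  apply: leq_trans (leq_add (leq_b1 _) cf) _.
  by apply: leq_trans (leq_add a1 cv) _; rewrite -mulSn.
apply: leq_trans cl (leq_trans cE _).
apply: leq_trans (leq_mul (leq_trans cBd (leq_mul (leqnn C) cY)) (leqnn _)) _.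
by move: (size E1) (size (enum_fset a)) => x y; clear; nia.
Qed.

Local Open Scope ereal_scope.

Theorem theoremB (R : realType) (G : groupType) (V : choiceType)
    (Z : simplicial_complex V) (act : simplicial_action G Z) :
  geometrically_rigid_hyperbolic R G ->
  acts_freely R act ->
  acts_cocompactly R act ->
  simply_connected R (realization R Z) ->
  0 < cheeger Z R 1.
Proof.
move=> rigidG freeA cocA scZ.
have [C CP] := bounded_primitives rigidG freeA cocA scZ.
(* [C.+1] because [C] may be 0. *)
apply: (@lt_le_trans _ _ ((C.+1%:R : R)^-1)%:E).
  by rewrite lte_fin invr_gt0 ltr0n.
apply: le_ereal_inf_tmp => _ [a [[l al] a0] <-]; rewrite lee_fin.
have lA : [set #|` l| | l in primitives Z 1 a] #|` l| by exists l.
have [[l0 al0 ml0] mle] := nat_minP lA; rewrite -/(min_prim Z 1 a) in ml0 mle.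
(* Ensures that [min_prim] is positive, so that the quotient is not the conventional value of a
   division by 0. *)
have l0_neq0 : l0 != fset0.
  apply: contraNneq a0 => l0E; apply/eqP/fsetP => t; rewrite inE; apply/negP => ta.
  case: al0 => _ /seteqP[_ /(_ t ta)[_]]; rewrite l0E.
  by rewrite (_ : [fset _ in _ | _]%fset = fset0) ?cardfs0 //; apply/fsetP => s; rewrite !inE.
have m_gt0 : (0 < min_prim Z 1 a)%N by rewrite -ml0 cardfs_gt0.
have [l' al' l'C] := CP l a al a0.
have mC : (min_prim Z 1 a <= C.+1 * #|` a|)%N.
  apply: leq_trans (mle _ _) _; first by exists l'.
  by apply: leq_trans l'C _; rewrite leq_mul2r leqnSn orbT.
rewrite ler_pdivlMr ?ltr0n // mulrC ler_pdivrMr ?ltr0n // mulrC.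
by rewrite -natrM ler_nat.
Qed.
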